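(* Let $f:\Omega_D\to\mathbb{O}$ be a slice Fueter-regular function. Suppose that either (1) $|f|$ attains a maximum at some point of $\Omega_D$, or (2) $|f|$ has a local maximum at some point of $\Omega_D\setminus V(f'_s)$. Then $f$ is constant.
   Context: Octonions $\mathbb{O}=\mathbb{H}+\ell\mathbb{H}$ (product $(a+\ell b)(c+\ell d)=(ac-d\bar b)+\ell(\bar a d+cb)$), identified with $\mathbb{R}^8$ with Euclidean norm $|\cdot|$; $\mathbb S=\{I:I^2=-1\}$. $D\subset\mathbb{R}^2$ non-empty open, invariant under $(x_0,x_1)\mapsto(x_0,-x_1)$, $\Omega_D=\{x_0+x_1I:(x_0,x_1)\in D,I\in\mathbb S\}$, assumed connected. Slice functions $f(x_0+x_1I)=F_1(x_0,x_1)+IF_2(x_0,x_1)$ with stem $(F_1,F_2)$, $F_1$ even and $F_2$ odd in $x_1$; spherical derivative $f'_s(x_0+x_1I)=F_2(x_0,x_1)/x_1$ on $\Omega_D\setminus\mathbb{R}$; $V(f'_s)=\{x\in\Omega_D\setminus\mathbb{R}:f'_s(x)=0\}$. Every slice Fueter-regular function is a slice function. Slice Fueter-regular: $E=\{(x_0,\dots,x_3):(x_0,(x_1^2+x_2^2+x_3^2)^{1/2})\in D\}$, $\mathcal N=\{(I,J)\in\mathbb S^2:I\perp J\}$, $O(3)$ the real orthogonal $4\times4$ matrices fixing the first basis vector acting by matrix–column multiplication; $f$ is slice Fueter-regular if there is $\mathcal F=(\mathcal F_0,\dots,\mathcal F_3):E\to\mathbb{O}^4$ of class $C^1$ with $\mathcal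 F(Av)=A\mathcal F(v)$, $f(x_0+x_1I+x_2J+x_3(IJ))=\mathcal F_0(v)+I\mathcal F_1(v)+J\mathcal F_2(v)+(IJ)\mathcal F_3(v)$ ($v\in E$, $(I,J)\in\mathcal N$), and $\partial_0\mathcal F_0-\partial_1\mathcal F_1-\partial_2\mathcal F_2-\partial_3\mathcal F_3=0$, $\partial_1\mathcal F_0+\partial_0\mathcal F_1-\partial_3\mathcal F_2+\partial_2\mathcal F_3=0$, $\partial_2\mathcal F_0+\partial_3\mathcal F_1+\partial_0\mathcal F_2-\partial_1\mathcal F_3=0$, $\partial_3\mathcal F_0-\partial_2\mathcal F_1+\partial_1\mathcal F_2+\partial_0\mathcal F_3=0$ on $E$. *)

(* Defs.v *)
From HB Require Import structures.
From mathcomp Require Import all_boot all_order all_algebra.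
From mathcomp Require Import all_classical all_reals all_analysis.
Set Implicit Arguments. Unset Strict Implicit. Unset Printing Implicit Defensive.
Import Order.TTheory GRing.Theory Num.Theory.
Import numFieldNormedType.Exports.
Local Open Scope classical_set_scope.
Local Open Scope ring_scope.

Section Octonions.
Variable R : realType.

Record quat := Quat { q0 : R; q1 : R; q2 : R; q3 : R }.

Definition qadd (a b : quat) : quat :=
  Quat (q0 a + q0 b) (q1 a + q1 b) (q2 a + q2 b) (q3 a + q3 b).
Definition qsub (a b : quat) : quat :=
  Quat (q0 a - q0 b) (q1 a - q1 b) (q2 a - q2 b) (q3 a - q3 b).
Definition qconj (a : quat) : quat := Quat (q0 a) (- q1 a) (- q2 a) (- q3 a).
Definition qmul (a b : quat) : quat :=
  Quat (q0 a * q0 b - q1 a * q1 b - q2 a * q2 b - q3 a * q3 b)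
       (q0 a * q1 b + q1 a * q0 b + q2 a * q3 b - q3 a * q2 b)
       (q0 a * q2 b - q1 a * q3 b + q2 a * q0 b + q3 a * q1 b)
       (q0 a * q3 b + q1 a * q2 b - q2 a * q1 b + q3 a * q0 b).

(* Octonions O = H + l H identified with R^8: the octonion a + l b has
   coordinates (a0,a1,a2,a3,b0,b1,b2,b3). *)
Definition oct := 'rV[R]_8.

Definition oc (x : oct) (k : nat) : R := x ord0 (inord k).
Definition oct_a (x : oct) : quat := Quat (oc x 0) (oc x 1) (oc x 2) (oc x 3).
Definition oct_b (x : oct) : quat := Quat (oc x 4) (oc x 5) (oc x 6) (oc x 7).
Definition mk_oct (a b : quat) : oct :=
  \row_(i < 8) nth 0 [:: q0 a; q1 a; q2 a; q3 a; q0 b; q1 b; q2 b; q3 b] i.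

(* (a + l b)(c + l d) = (ac - d conj(b)) + l (conj(a) d + c b) *)
Definition omul (x y : oct) : oct :=
  let a := oct_a x in let b := oct_b x in
  let c := oct_a y in let d := oct_b y in
  mk_oct (qsub (qmul a c) (qmul d (qconj b))) (qadd (qmul (qconj a) d) (qmul c b)).

Definition oreal (r : R) : oct := mk_oct (Quat r 0 0 0) (Quat 0 0 0 0).

Definition oinner (x y : oct) : R := \sum_(i < 8) x ord0 i * y ord0 i.
Definition onorm (x : oct) : R := Num.sqrt (oinner x x).

Definition sphereS : set oct := [set I | omul I I = - oreal 1].

Definition OmegaD (D : set (R * R)) : set oct :=
  [set x | exists x0 x1 I, D (x0, x1) /\ sphereS I /\ x = oreal x0 + x1 *: I].

Definition i0 : 'I_4 := @Ordinal 4 0 isT.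
Definition i1 : 'I_4 := @Ordinal 4 1 isT.
Definition i2 : 'I_4 := @Ordinal 4 2 isT.
Definition i3 : 'I_4 := @Ordinal 4 3 isT.
Definition ebas (i : 'I_4) : 'cV[R]_4 := delta_mx i 0.
Definition vc (v : 'cV[R]_4) (i : 'I_4) : R := v i 0.

Definition Eset (D : set (R * R)) : set 'cV[R]_4 :=
  [set v | D (vc v i0, Num.sqrt (vc v i1 ^+ 2 + vc v i2 ^+ 2 + vc v i3 ^+ 2))].

Definition O3 (A : 'M[R]_4) : Prop := A^T *m A = 1%:M /\ A *m ebas i0 = ebas i0.

Definition pd (g : 'cV[R]_4 -> oct) (i : 'I_4) (v : 'cV[R]_4) : oct :=
  derive g v (ebas i).

Definition C1_on (E : set 'cV[R]_4) (g : 'cV[R]_4 -> oct) : Prop :=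
  forall i : 'I_4, (forall v, E v -> derivable g v (ebas i)) /\
                   {in E, continuous (pd g i)}.

Definition slice_fueter_regular (D : set (R * R)) (f : oct -> oct) : Prop :=
  exists F : 'I_4 -> 'cV[R]_4 -> oct,
    (forall k, C1_on (Eset D) (F k)) /\
    (forall A v, O3 A -> Eset D v ->
       forall i, F i (A *m v) = \sum_(j < 4) A i j *: F j v) /\
    (forall v I J, Eset D v -> sphereS I -> sphereS J -> oinner I J = 0 ->
       f (oreal (vc v i0) + vc v i1 *: I + vc v i2 *: J + vc v i3 *: omul I J)
       = F i0 v + omul I (F i1 v) + omul J (F i2 v) + omul (omul I J) (F i3 v)) /\
    (forall v, Eset D v ->
       [/\ pd (F i0) i0 v - pd (F i1) i1 v - pd (F i2) i2 v - pd (F i3) i3 v = 0,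
           pd (F i0) i1 v + pd (F i1) i0 v - pd (F i2) i3 v + pd (F i3) i2 v = 0,
           pd (F i0) i2 v + pd (F i1) i3 v + pd (F i2) i0 v - pd (F i3) i1 v = 0 &
           pd (F i0) i3 v - pd (F i1) i2 v + pd (F i2) i1 v + pd (F i3) i0 v = 0]).

Definition is_stem (D : set (R * R)) (f : oct -> oct) (F1 F2 : R -> R -> oct) :=
  (forall x0 x1, D (x0, x1) -> F1 x0 (- x1) = F1 x0 x1 /\ F2 x0 (- x1) = - F2 x0 x1) /\
  (forall x0 x1 I, D (x0, x1) -> sphereS I ->
     f (oreal x0 + x1 *: I) = F1 x0 x1 + omul I (F2 x0 x1)).

(* V(f'_s): points x = x0 + x1 I of Omega_D \ R where the spherical
   derivative f'_s(x) = F2(x0,x1)/x1 vanishes *)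
Definition Vsd (D : set (R * R)) (f : oct -> oct) : set oct :=
  [set x | exists F1 F2 x0 x1 I, is_stem D f F1 F2 /\ D (x0, x1) /\ sphereS I /\
     x1 != 0 /\ x = oreal x0 + x1 *: I /\ x1^-1 *: F2 x0 x1 = 0].

End Octonions.

(* Main.v *)
(* Write f(x + yK) = u(x,y) + K v(x,y).  The reflections in O(3) turn the Fueter system into
   u_y = - v_x and u_x = v_y + 2v/y, so (-u, v) is locally the gradient of some c, and
   c(x_0, |(x_1,x_2,x_3)|) is harmonic on R^4.  Difference quotients of this C^2 function
   approximate u and the components of Kv uniformly, although f itself is only C^1.

   If |f| has a local maximum at p = a + bI and e = f(p), then <f,e> <= <e,e> near p; averaging
   over K = cos(t) I +- sin(t) J yields a limit of harmonic functions on R^4 with a local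
   maximum, so Hopf's strong maximum principle makes it constant, whence f = e near p.

   Finally y c is harmonic in the plane; with a harmonic conjugate it is the real part of a
   holomorphic function, and a weighted maximum principle gives unique continuation, so the
   set of points near which f = e is open and closed in the connected set Omega_D. *)
Require Import Defs.
From HB Require Import structures.
From mathcomp Require Import all_boot all_order all_algebra.
From mathcomp Require Import all_classical all_reals all_analysis.
From mathcomp Require Import ring lra.
Import Order.TTheory GRing.Theory Num.Theory.
Import numFieldNormedType.Exports.
Local Open Scope classical_set_scope.
Local Open Scope ring_scope.
Set Implicit Arguments. Unset Strict Implicit. Unset Printing Implicit Defensive.

(** The term [2v/y] is the first-order part of the radial Laplacian in three imaginary directions;
    this is what ties the system to harmonic functions of four variables. But [u] and [(w_1/r) v]
    are, up to sign, partial derivatives of radial potentials along axes 0 and 1. The maximum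
    principle is therefore proved for uniform limits of harmonic functions. Averaging over
    [K = cos(t) I +- sin(t) J] removes the [J]-part and leaves [u + cos(t) I v], which with
    [cos(t) = w_1/r] has exactly this form. Pairing with [e] moves [I] to the other factor, so the
    potentials of two functionals occur, those of [e] and of [- I e]. Once the average is [<e,e>],
    the bound [|f| <= |e|] forces both values to be [e], and two distinct units [K] then force
    [v = 0]. In place of associativity only [I (I v) = - v] and the skew-adjointness of left
    multiplication by [I] are used. *)

(** * Pointwise continuity of real-valued functions *)

Section Continuity.
Variables (R : realType) (T : topologicalType).
Implicit Types (f g : T -> R) (x : T).

Lemma ctsP f x : {for x, continuous f} <->
  forall e : R, 0 < e -> \forall t \near x, `|f x - f t| < e.
Proof. by split=> [/cvgrPdist_lt //|H]; apply/cvgrPdist_lt. Qed.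

Lemma cts_cst (c : R) x : {for x, continuous (fun=> c : R)}.
Proof. exact: cvg_cst. Qed.

Lemma ctsD f g x : {for x, continuous f} -> {for x, continuous g} ->
  {for x, continuous (fun t => f t + g t)}.
Proof. by move=> cf cg; exact: cvgD. Qed.

Lemma ctsB f g x : {for x, continuous f} -> {for x, continuous g} ->
  {for x, continuous (fun t => f t - g t)}.
Proof. by move=> cf cg; exact: cvgB. Qed.

Lemma ctsN f x : {for x, continuous f} -> {for x, continuous (fun t => - f t)}.
Proof. by move=> cf; exact: cvgN. Qed.

Lemma ctsM f g x : {for x, continuous f} -> {for x, continuous g} ->
  {for x, continuous (fun t => f t * g t)}.
Proof. by move=> cf cg; exact: cvgM. Qed.

Lemma ctsX f x n : {for x, continuous f} -> {for x, continuous (fun t => f t ^+ n)}.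
Proof.
move=> cf; elim: n => [|n IH]; first exact: cvg_cst.
rewrite (_ : (fun t => _) = fun t => f t * f t ^+ n); first exact: ctsM.
by apply/funext => t; rewrite exprS.
Qed.

Lemma ctsV f x : f x != 0 -> {for x, continuous f} ->
  {for x, continuous (fun t => (f t)^-1)}.
Proof. by move=> fx cf; exact: cvgV. Qed.

Lemma cts_comp (g : R -> R) f x : {for f x, continuous g} -> {for x, continuous f} ->
  {for x, continuous (fun t => g (f t))}.
Proof. by move=> cg cf; exact: (continuous_comp cf cg). Qed.

Lemma cts_sum n (F : 'I_n -> T -> R) x : (forall i, {for x, continuous (F i)}) ->
  {for x, continuous (fun t => \sum_(i < n) F i t)}.
Proof.
elim: n F => [|n IH] F cF.
  rewrite (_ : (fun t => _) = fun=> 0); first exact: cts_cst.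
  by apply/funext => t; rewrite big_ord0.
rewrite (_ : (fun t => _) = fun t => F ord0 t + \sum_(i < n) F (lift ord0 i) t).
  by apply: ctsD => //; exact: IH.
by apply/funext => t; rewrite big_ord_recl.
Qed.

End Continuity.

(** * Derivatives in one variable *)

Section Calculus.
Variable R : realType.
Implicit Types (f g : R -> R) (x d : R).

(** A relation with an explicit value: a computation composes the rules below and then adjusts the
    resulting value with [der_eq]. *)
Definition der f x d : Prop := is_derive x 1 f d.

Lemma der_eq f x d d' : der f x d -> d = d' -> der f x d'.
Proof. by move=> ? <-. Qed.

Lemma der_cst (c x : R) : der (fun=> c) x 0.
Proof. exact: is_derive_cst. Qed.

Lemma der_id x : der (fun t : R => t) x 1.
Proof. exact: is_derive_id. Qed.

Lemma derD f g x d d' : der f x d -> der g x d' ->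
  der (fun t => f t + g t) x (d + d').
Proof. by move=> ? ?; exact: is_deriveD. Qed.

Lemma derN f x d : der f x d -> der (fun t => - f t) x (- d).
Proof. by move=> ?; exact: is_deriveN. Qed.

Lemma derB f g x d d' : der f x d -> der g x d' ->
  der (fun t => f t - g t) x (d - d').
Proof. by move=> ? ?; exact: is_deriveB. Qed.

Lemma derM f g x d d' : der f x d -> der g x d' ->
  der (fun t => f t * g t) x (f x * d' + g x * d).
Proof. by move=> ? ?; exact: is_deriveM. Qed.

Lemma derMl f x d (k : R) : der f x d ->
  der (fun t => k * f t) x (k * d).
Proof. by move=> fd; apply: der_eq (derM (der_cst k x) fd) _; rewrite mulr0 addr0. Qed.

Lemma der_sqr f x d : der f x d ->
  der (fun t => f t ^+ 2) x (2 * f x * d).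
Proof.
move=> fd; rewrite (_ : (fun t => f t ^+ 2) = (fun t => f t * f t)).
  by apply: der_eq (derM fd fd) _; ring.
by apply/funext => t; rewrite expr2.
Qed.

Lemma derV f x d : f x != 0 -> der f x d ->
  der (fun t => (f t)^-1) x (- (f x) ^- 2 * d).
Proof. by move=> ? ?; exact: is_deriveV. Qed.

Lemma der_comp f g x d d' : der f (g x) d -> der g x d' ->
  der (fun t => f (g t)) x (d * d').
Proof. by move=> ? ?; exact: is_derive1_comp. Qed.

Lemma der_near f g x d : (\forall t \near x, f t = g t) ->
  der f x d -> der g x d.
Proof. exact: near_eq_is_derive. Qed.

Lemma der_shift f x d (a : R) : der f (a + x) d ->
  der (fun t => f (a + t)) x d.
Proof.
move=> fd; apply: der_eq (der_comp fd (derD (der_cst a x) (der_id x))) _.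
by rewrite add0r mulr1.
Qed.

Lemma der_unique f x d d' : der f x d -> der f x d' -> d = d'.
Proof. by move=> [_ <-] [_ <-]. Qed.

Lemma der_continuous f x d : der f x d -> {for x, continuous f}.
Proof. by move=> [fd _]; apply/differentiable_continuous/derivable1_diffP. Qed.

Lemma mean_value f f' (a b : R) : a < b ->
  (forall t, a <= t <= b -> der f t (f' t)) ->
  exists2 t, a < t < b & f b - f a = f' t * (b - a).
Proof.
move=> ab fd.
have [||t] := MVT (f := f) (df := f') ab.
- by move=> t /[!in_itv]/= /andP[a_t tb]; apply: fd; rewrite !ltW.
- apply/continuous_in_subspaceT => t /set_mem /= /[!in_itv]/= /fd.
  exact: der_continuous.
by rewrite in_itv => tab E; exists t.
Qed.

Lemma max_der0 f x d (e : R) : 0 < e ->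
  (forall t, `|t - x| < e -> exists d', der f t d') ->
  (forall t, `|t - x| < e -> f t <= f x) ->
  der f x d -> d = 0.
Proof.
move=> e0 fd fx fxd; apply: (der_unique fxd).
have xe t : t \in `]x - e, x + e[ -> `|t - x| < e.
  by rewrite in_itv /= ltr_distl.
apply: (@derive1_at_max _ f (x - e) (x + e)).
- by lra.
- by move=> t /xe /fd[? []].
- by rewrite in_itv /=; apply/andP; split; lra.
- by move=> t /xe /fx.
Qed.

(** If [d > 0], then [f1 x = 0] makes [f1] positive just to the right of [x], and the mean value
    theorem puts [f] above [f x] there. Differentiability of [f1] at the single point [x]
    suffices. *)
Lemma second_derivative_test f f1 x d (e : R) : 0 < e ->
  (forall t, `|t - x| < e -> der f t (f1 t)) ->
  (forall t, `|t - x| < e -> f t <= f x) ->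
  der f1 x d -> d <= 0.
Proof.
move=> e0 fd fx f1d; rewrite leNgt; apply/negP => d0.
have f1x : f1 x = 0.
  apply: (max_der0 e0 _ fx) => [t te|]; first by exists (f1 t); exact: fd.
  by apply: fd; rewrite subrr normr0.
case: f1d => f1d dE.
have /cvgrPdist_lt /(_ _ d0) : h^-1 *: (f1 (h *: 1 + x) - f1 x) @[h --> 0^'] --> d.
  by rewrite -dE; exact: f1d.
move=> [r /= r0 rP].
pose h := Num.min (r / 2) (e / 2).
have h0 : 0 < h by rewrite lt_min !divr_gt0.
have [hr he] : h < r /\ h < e.
  by rewrite !gt_min; split; apply/orP; [left|right]; lra.
have f1pos t : x < t -> t <= x + h -> 0 < f1 t.
  move=> xt th; have := rP (t - x); rewrite /ball_ /= sub0r normrN.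
  have tx0 : 0 < t - x by lra.
  rewrite gtr0_norm// => /(_ _ (lt0r_neq0 tx0)).
  rewrite f1x subr0 /GRing.scale /= mulr1 subrK.
  have txr : t - x < r by lra.
  move=> /(_ txr); rewrite ltr_distlC => /andP[+ _]; rewrite subrr.
  by rewrite pmulr_rgt0// invr_gt0.
have [t /andP[xt th]] : exists2 t, x < t < x + h & f (x + h) - f x = f1 t * (x + h - x).
  apply: mean_value; first by lra.
  move=> t /andP[? ?]; apply: fd; rewrite ger0_norm; lra.
have := f1pos t xt (ltW th).
have := fx (x + h); rewrite (_ : x + h - x = h); last by ring.
rewrite gtr0_norm// => /(_ he).
nra.
Qed.

End Calculus.

(** * Functions of two real variables and potentials of closed forms *)

Section Plane.
Variable R : realType.
Implicit Types (U Ux Uy P Q Py c : R -> R -> R).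

Definition cts2 U (x y : R) := {for (x, y), continuous (fun z : R * R => U z.1 z.2)}.

Lemma near2P (x y : R) (A : R * R -> Prop) : (\forall z \near (x, y), A z) <->
  exists2 e : R, 0 < e & forall x' y', `|x' - x| < e -> `|y' - y| < e -> A (x', y').
Proof.
split.
  move=> /nbhs_ballP[e /= e0 eA]; exists e => // x' y' xe ye.
  by apply: eA; split => /=; rewrite /ball /= distrC.
move=> [e e0 eA]; apply/nbhs_ballP; exists e => //= -[x' y'] [/= xe ye].
by apply: eA; rewrite distrC.
Qed.

Lemma cts2P U (x y : R) : cts2 U x y <-> forall e : R, 0 < e -> exists2 r : R, 0 < r &
  forall x' y', `|x' - x| < r -> `|y' - y| < r -> `|U x' y' - U x y| < e.
Proof.
split.
  move=> /cvgrPdist_lt H e e0; have /near2P[r r0 rH] := H e e0.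
  by exists r => // x' y' xr yr; rewrite distrC; exact: (rH _ _ xr yr).
move=> H; apply/cvgrPdist_lt => e e0; apply/near2P; have [r r0 rH] := H e e0.
by exists r => // x' y' xr yr /=; rewrite distrC; exact: rH.
Qed.

Lemma cts2_slice1 U (x y : R) : cts2 U x y -> {for x, continuous (U ^~ y)}.
Proof.
move=> /cts2P H; apply/cvgrPdist_lt => e /H[r r0 rH].
apply/nbhs_ballP; exists r => //= x'; rewrite /ball /= => xx.
by rewrite distrC; apply: rH; rewrite 1?distrC// subrr normr0.
Qed.

Lemma cts2_slice2 U (x y : R) : cts2 U x y -> {for y, continuous (U x)}.
Proof.
move=> /cts2P H; apply/cvgrPdist_lt => e /H[r r0 rH].
apply/nbhs_ballP; exists r => //= x'; rewrite /ball /= => xx.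
by rewrite distrC; apply: rH; rewrite 1?distrC// subrr normr0.
Qed.

Lemma bounded_der_lip (f f' : R -> R) (M e x t : R) :
  (forall s, `|s - x| < e -> der f s (f' s) /\ `|f' s| <= M) ->
  `|t - x| < e -> `|f t - f x| <= M * `|t - x|.
Proof.
move=> fd te.
have key a b : a < b -> (forall s, a <= s <= b -> `|s - x| < e) ->
    `|f b - f a| <= M * (b - a).
  move=> ab abe; have [|s /andP[s1 s2] ->] := @mean_value R f f' _ _ ab.
    by move=> s sab; apply: (fd s (abe _ sab)).1.
  have se : `|s - x| < e by apply: abe; rewrite !ltW.
  by rewrite normrM (gtr0_norm (_ : 0 < b - a)) ?subr_gt0// ler_pM2r ?subr_gt0//;
    exact: (fd s se).2.
have [tx|xt|->] := ltgtP t x.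
- rewrite distrC (distrC t) (gtr0_norm (_ : 0 < x - t)) ?subr_gt0//.
  apply: key => // s /andP[ts sx]; apply: le_lt_trans te.
  by rewrite (distrC t) (ger0_norm (_ : 0 <= x - t)) ?(distrC s) ?ger0_norm; lra.
- rewrite (gtr0_norm (_ : 0 < t - x)) ?subr_gt0//.
  apply: key => // s /andP[xs st]; apply: le_lt_trans te.
  by rewrite (ger0_norm (_ : 0 <= t - x)) ?ger0_norm; lra.
- by rewrite !subrr normr0 mulr0.
Qed.

Lemma cts2_bounded U (x y : R) : cts2 U x y -> exists2 r : R, 0 < r &
  forall x' y', `|x' - x| < r -> `|y' - y| < r -> `|U x' y'| <= `|U x y| + 1.
Proof.
move=> /cts2P /(_ _ ltr01)[r r0 rH]; exists r => // x' y' xr yr.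
rewrite -lerBlDl; apply: le_trans (ltW (rH _ _ xr yr)).
exact: le_trans (lerB_dist _ _) (lexx _).
Qed.

(** Continuity of the partial derivatives at the point serves only to bound them nearby; moving
    first along one axis and then along the other gives a Lipschitz estimate with constant [M]. *)
Lemma partials_cts2 U Ux Uy (x y e1 : R) : 0 < e1 ->
  (forall x' y', `|x' - x| < e1 -> `|y' - y| < e1 ->
     der (U ^~ y') x' (Ux x' y') /\ der (U x') y' (Uy x' y')) ->
  cts2 Ux x y -> cts2 Uy x y -> cts2 U x y.
Proof.
move=> e10 dxy /cts2_bounded[e3 e30 bx] /cts2_bounded[e4 e40 b_y].
have [e e0 le_e] : exists2 e : R, 0 < e &
    forall t, t < e -> [/\ t < e1, t < e3 & t < e4].
  exists (Num.min e1 (Num.min e3 e4)); first by rewrite !lt_min e10 e30 e40.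
  by move=> t; rewrite !lt_min => /andP[-> /andP[-> ->]].
have z0 (t : R) : `|t - t| < e by rewrite subrr normr0.
pose M : R := `|Ux x y| + 1 + (`|Uy x y| + 1).
have M0 : 0 < M by rewrite ltr_wpDl// ltr_wpDl.
apply/cts2P => eps eps0.
exists (Num.min e (eps / (2 * M))); first by rewrite lt_min e0 divr_gt0// mulr_gt0.
move=> x' y'; rewrite !lt_min => /andP[xe xM] /andP[ye yM].
have h1 : `|U x' y' - U x y'| <= M * `|x' - x|.
  apply: (@bounded_der_lip (U ^~ y') (Ux ^~ y') M e x x') => [s se|//]; split.
    by have [? ? ?] := le_e _ se; have [? ? ?] := le_e _ ye; case: (dxy s y').
  have [? ? ?] := le_e _ se; have [? ? ?] := le_e _ ye.
  by apply: le_trans (bx _ _ _ _) _ => //; rewrite lerDl addr_ge0.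
have h2 : `|U x y' - U x y| <= M * `|y' - y|.
  apply: (@bounded_der_lip (U x) (Uy x) M e y y') => [s se|//].
  have [? ? ?] := le_e _ se; have [? ? ?] := le_e _ (z0 x).
  split; first by case: (dxy x s).
  by apply: le_trans (b_y _ _ _ _) _ => //; rewrite lerDr addr_ge0.
have M1 : M * (eps / (2 * M)) = eps / 2 by field; rewrite lt0r_neq0.
have := ler_normD (U x' y' - U x y') (U x y' - U x y); rewrite subrKA => h3.
have := ltr_pM2l M0 `|x' - x| (eps / (2 * M)); rewrite xM M1 => h4.
have := ltr_pM2l M0 `|y' - y| (eps / (2 * M)); rewrite yM M1 => h5.
by lra.
Qed.

Lemma cts2_bounded_rect U (a b a' b' : R) :
  (forall x y, a <= x <= b -> a' <= y <= b' -> cts2 U x y) ->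
  exists2 M : R, 0 <= M & forall x y, a <= x <= b -> a' <= y <= b' -> `|U x y| <= M.
Proof.
move=> cU.
have cK : compact (`[a, b]%classic `*` `[a', b']%classic).
  by apply: compact_setX; exact: segment_compact.
have cUK : {within `[a, b]%classic `*` `[a', b']%classic,
    continuous (fun z : R * R => U z.1 z.2)}.
  apply/continuous_in_subspaceT => -[x y] /set_mem /= [/=].
  by rewrite !in_itv/=; exact: cU.
have [M [Mr MK]] := compact_bounded (continuous_compact cUK cK).
exists (`|M| + 1); first by rewrite addr_ge0.
move=> x y xab yab; apply: MK; first by rewrite (le_lt_trans (ler_norm _))// ltrDl.
by exists (x, y) => //; split; rewrite /= in_itv.
Qed.

Local Notation mu := lebesgue_measure.

Lemma cts_seg_integrable (f : R -> R) (a b : R) :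
  (forall x, a <= x <= b -> {for x, continuous f}) ->
  mu.-integrable `[a, b] (EFin \o f).
Proof.
move=> cf; apply: continuous_compact_integrable; first exact: segment_compact.
by apply/continuous_in_subspaceT => x /set_mem /=; rewrite in_itv => /cf.
Qed.

Lemma primitive_der (f : R -> R) (a b x : R) :
  (forall t, a <= t <= b -> {for t, continuous f}) -> a < x < b ->
  der (fun x => \int[mu]_(t in `[a, x]) f t) x (f x).
Proof.
move=> cf /andP[ax xb].
have [|] := @continuous_FTC1_closed R f a x b xb (cts_seg_integrable cf) ax.
  by apply: cf; rewrite !ltW.
by move=> d e; exact: (DeriveDef d (etrans (esym (derive1E _ _)) e)).
Qed.

Lemma integral_der (f f' : R -> R) (a b : R) : a < b ->
  (forall t, a <= t <= b -> der f t (f' t)) ->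
  (forall t, a <= t <= b -> {for t, continuous f'}) ->
  \int[mu]_(t in `[a, b]) f' t = f b - f a.
Proof.
move=> ab fd cf'.
have cf t : a <= t <= b -> {for t, continuous f}.
  by move=> /fd; exact: der_continuous.
rewrite /Rintegral (@continuous_FTC2 R f' f)//.
- by apply/continuous_in_subspaceT => x /set_mem /=; rewrite in_itv => /cf'.
- split.
  + by move=> x; rewrite in_itv /= => /andP[ax xb]; case: (fd x); rewrite ?ltW.
  + by apply: cvg_at_right_filter; apply: cf; rewrite lexx ltW.
  + by apply: cvg_at_left_filter; apply: cf; rewrite lexx ltW.
- move=> x; rewrite in_itv /= => /andP[ax xb].
  by rewrite derive1E; case: (fd x); rewrite ?ltW.
Qed.

(** Closedness of [P dx + Q dy] is encoded by [Py] being both the y-derivative of [P] and the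
    x-derivative of [Q]. The potential integrates [Q] up the left edge and then [P] horizontally;
    its y-derivative comes from differentiation under the integral sign, dominated by a bound of
    [Py] on the closed rectangle. *)
Lemma poincare P Q Py (a b a' b' : R) :
  (forall x y, a <= x <= b -> a' <= y <= b' ->
    [/\ cts2 P x y, cts2 Q x y, cts2 Py x y, der (P x) y (Py x y)
      & der (Q ^~ y) x (Py x y)]) ->
  exists c : R -> R -> R, forall x y, a < x < b -> a' < y < b' ->
    der (c ^~ y) x (P x y) /\ der (c x) y (Q x y).
Proof.
move=> H.
pose I1 (x y : R) : R := \int[mu]_(s in `[a, x]) P s y.
pose I2 (y : R) : R := \int[mu]_(t in `[a', y]) Q a t.
exists (fun x y => I1 x y + I2 y) => x y xab yab.
have [ax xb] := andP xab; have [ay yb] := andP yab.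
have ab : a < b by lra.
have xab' : a <= x <= b by rewrite !ltW.
have yab' : a' <= y <= b' by rewrite !ltW.
split.
  rewrite -[P x y]addr0.
  apply: (@derD _ (I1 ^~ y) (fun=> I2 y)); last exact: der_cst.
  apply: (@primitive_der (P ^~ y) a b) => // t tab.
  by have [/cts2_slice1] := H t y tab yab'.
have [M M0 MP] : exists2 M : R, 0 <= M &
    forall x y, a <= x <= b -> a' <= y <= b' -> `|Py x y| <= M.
  by apply: cts2_bounded_rect => s t sab tab; have [] := H s t sab tab.
have sax s : `[a, x]%classic s -> a <= s <= b.
  by rewrite /= in_itv /= => /andP[-> sx]; lra.
have tay t : `]a', b'[%classic t -> a' <= t <= b'.
  by rewrite /= in_itv /= => /andP[? ?]; rewrite !ltW.
have d1 t s : `]a', b'[%classic t -> `[a, x]%classic s ->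
    partial1of2 (fun t s => P s t) t s = Py s t.
  move=> /tay tt /sax ss; rewrite /partial1of2 derive1E.
  by have [_ _ _ [_ <-] _] := H s t ss tt.
have -> : Q x y = \int[mu]_(s in `[a, x]) Py s y + Q a y.
  rewrite (@integral_der (Q ^~ y) (Py ^~ y))// ?subrK// => t /andP[ta tx].
  - have tab : a <= t <= b by lra.
    by have [] := H t y tab yab'.
  - have tab : a <= t <= b by lra.
    by have [_ _ /cts2_slice1] := H t y tab yab'.
apply: (@derD _ (I1 x) I2); last first.
  apply: (@primitive_der (Q a) a' b') => // t tab.
  have aab : a <= a <= b by rewrite lexx ltW.
  by have [_ /cts2_slice2] := H a t aab tab.
have Iy : `]a', b'[%classic y by rewrite /= in_itv /= ay yb.
have intP t : `]a', b'[%classic t -> mu.-integrable `[a, x] (EFin \o (P ^~ t)).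
  move=> /tay tt; apply: cts_seg_integrable => s /andP[sa sx].
  have ss : a <= s <= b by lra.
  by have [/cts2_slice1] := H s t ss tt.
have dP t s : `]a', b'[%classic t -> `[a, x]%classic s -> derivable (P s) t 1.
  by move=> /tay tt /sax ss; have [_ _ _ []] := H s t ss tt.
have intM : mu.-integrable `[a, x] (EFin \o (fun=> M)).
  by apply: cts_seg_integrable => s _; exact: cst_continuous.
have GM t s : `]a', b'[%classic t -> `[a, x]%classic s ->
    `|partial1of2 (fun t s => P s t) t s| <= M.
  by move=> tt ss; rewrite d1//; apply: MP; [exact: sax|exact: tay].
have mI : measurable (`[a, x]%classic : set (measurableTypeR R)) by [].
apply: DeriveDef.
  exact: (derivable_under_integral mI Iy intP dP (fun=> M0) intM GM).
rewrite -derive1E (differentiation_under_integral mI Iy intP dP (fun=> M0) intM GM).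
by apply: eq_Rintegral => s /set_mem ss; rewrite d1.
Qed.

End Plane.

(** * Harmonic functions on R^4 and Hopf's strong maximum principle *)

Section StrongMaximum.
Variable R : realType.
Local Notation V := 'rV[R]_4.
Implicit Types (v w z p q y : V) (s S T L : V -> R) (i j : 'I_4).

Definition bas i : V := delta_mx ord0 i.

Lemma basE i j : bas i ord0 j = (j == i)%:R.
Proof. by rewrite mxE eqxx. Qed.

Lemma coord_norm_le v j : `|v ord0 j| <= `|v|.
Proof.
rewrite [leRHS]/Num.Def.normr /= mx_normrE.
exact: (le_bigmax _ (fun ij : 'I_1 * 'I_4 => `|v ij.1 ij.2|) (ord0, j)).
Qed.

Lemma norm_le_coord v (r : R) : 0 <= r -> (forall j, `|v ord0 j| <= r) -> `|v| <= r.
Proof.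
move=> r0 H; rewrite [leLHS]/Num.Def.normr /= mx_normrE.
by apply: bigmax_le => // -[a j] _ /=; rewrite (ord1 a).
Qed.

Lemma norm_bas i : `|bas i| <= 1.
Proof.
apply: norm_le_coord => // j; rewrite basE.
by case: eqP => _; rewrite ?normr1 ?normr0.
Qed.

Lemma norm_shift_bas v i (t : R) : `|v + t *: bas i| <= `|v| + `|t|.
Proof.
apply: le_trans (ler_normD _ _) _; rewrite lerD2l normrZ.
by rewrite ler_piMr// norm_bas.
Qed.

(** [S1] and [S2] are the pure first and second partial derivatives. Neither mixed derivatives nor
    continuity are asked for, since the second derivative test along the axes uses neither. *)
Definition has_laplacian (A : set V) S L := exists S1 S2 : 'I_4 -> V -> R,
  forall v, A v -> [/\ forall i, der (fun t => S (v + t *: bas i)) 0 (S1 i v),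
    forall i, der (fun t => S1 i (v + t *: bas i)) 0 (S2 i v)
    & \sum_i S2 i v = L v].

Lemma has_laplacianD (A : set V) S T L L' :
  has_laplacian A S L -> has_laplacian A T L' ->
  has_laplacian A (fun v => S v + T v) (fun v => L v + L' v).
Proof.
move=> [S1 [S2 HS]] [T1 [T2 HT]].
exists (fun i v => S1 i v + T1 i v), (fun i v => S2 i v + T2 i v) => v Av.
have [a1 a2 a3] := HS v Av; have [b1 b2 b3] := HT v Av.
split=> [i|i|]; first exact: derD; first exact: derD.
by rewrite big_split /= a3 b3.
Qed.

Lemma has_laplacianZ (A : set V) S L (k : R) : has_laplacian A S L ->
  has_laplacian A (fun v => k * S v) (fun v => k * L v).
Proof.
move=> [S1 [S2 HS]].
exists (fun i v => k * S1 i v), (fun i v => k * S2 i v) => v Av.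
have [a1 a2 a3] := HS v Av.
split=> [i|i|]; first exact: derMl; first exact: derMl.
by rewrite -mulr_sumr a3.
Qed.

Lemma has_laplacian_sub (A B : set V) S L :
  B `<=` A -> has_laplacian A S L -> has_laplacian B S L.
Proof. by move=> BA [S1 [S2 H]]; exists S1, S2 => v /BA /H. Qed.

Lemma der_line S v i (t d : R) :
  der (fun u => S (v + t *: bas i + u *: bas i)) 0 d ->
  der (fun u => S (v + u *: bas i)) t d.
Proof.
move=> H.
have -> : (fun u : R => S (v + u *: bas i)) =
    (fun u => (fun u => S (v + t *: bas i + u *: bas i)) (- t + u)).
  by apply/funext => u; rewrite -addrA -scalerDl addNKr.
by apply: (@der_shift _ (fun u => S (v + t *: bas i + u *: bas i))); rewrite addNr.
Qed.

Lemma norm_sub_cts z v : {for v, continuous (fun w => `|w - z|)}.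
Proof.
apply/ctsP => e e0; apply/nbhs_ballP; exists e => //= w.
rewrite -ball_normE /= => vw; apply: le_lt_trans vw.
rewrite (_ : v - w = (v - z) - (w - z)); first exact: ler_dist_dist.
by rewrite opprB addrA subrK.
Qed.

Lemma closed_le_preimage s (r : R) : continuous s -> closed [set v | s v <= r].
Proof. by move=> cs; apply: (@closed_comp _ _ s [set x : R | x <= r]) => //; exact: closed_le. Qed.

Lemma cball_compact z (r : R) : compact [set v | `|v - z| <= r].
Proof.
apply: bounded_closed_compact.
  exists (r + `|z|); split; first exact: num_real.
  move=> M rM v /= vr; apply: le_trans (ltW rM).
  by rewrite -(subrK z v); apply: le_trans (ler_normD _ _) _; rewrite lerD2r.
apply: closed_le_preimage => v; exact: norm_sub_cts.
Qed.

(** At an interior maximum each pure second derivative is nonpositive, against [0 < L]; so the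
    maximum over the compact cube lies on its boundary. *)
Lemma maximum_principle S L z (r : R) : 0 < r ->
  has_laplacian [set v | `|v - z| < r] S L ->
  (forall v, `|v - z| < r -> 0 < L v) ->
  (forall v, `|v - z| <= r -> {for v, continuous S}) ->
  forall v, `|v - z| <= r -> exists2 w, `|w - z| = r & S v <= S w.
Proof.
move=> r0 [S1 [S2 HS]] L0 cS v vr.
have [||c /set_mem /= cr cmax] := compact_EVT_max (f := S) _ (@cball_compact z r).
- by exists v.
- by apply/continuous_in_subspaceT => w /set_mem /=; exact: cS.
exists c; last by apply: cmax; rewrite inE.
move: cr; rewrite le_eqVlt => /orP[/eqP//|cr]; exfalso.
have [_ d2 SL] := HS c cr.
suff : \sum_i S2 i c <= 0 by rewrite SL leNgt L0.
apply: sumr_le0 => i _.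
have e0 : 0 < r - `|c - z| by rewrite subr_gt0.
have near t : `|t - 0| < r - `|c - z| -> `|c + t *: bas i - z| < r.
  rewrite subr0 ltrBrDl; apply: le_lt_trans.
  by rewrite addrAC; exact: norm_shift_bas.
apply: (second_derivative_test (f := fun t => S (c + t *: bas i))
  (f1 := fun t => S1 i (c + t *: bas i)) e0 _ _ (d2 i)) => t tr.
  by apply: der_line; have [] := HS _ (near t tr).
by rewrite scale0r addr0; apply: cmax; rewrite inE /= ltW// near.
Qed.

(** The norm on row vectors is the maximum norm, whose balls are cubes; Hopf's argument needs round
    balls, hence this squared Euclidean distance. The factor 4 in [sqdist_le] is the dimension. *)
Definition sqdist y v : R := \sum_j (v ord0 j - y ord0 j) ^+ 2.

Lemma sqdist_ge0 y v : 0 <= sqdist y v.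
Proof. by apply: sumr_ge0 => j _; rewrite sqr_ge0. Qed.

Lemma sqdist_eq0 y v : sqdist y v = 0 -> v = y.
Proof.
move=> /eqP; rewrite psumr_eq0 => [/allP H|j _]; last by rewrite sqr_ge0.
apply/rowP => j; have := H j; rewrite mem_index_enum => /(_ isT).
by rewrite sqrf_eq0 subr_eq0 => /eqP.
Qed.

Lemma sqdistxx y : sqdist y y = 0.
Proof. by rewrite /sqdist big1// => j _; rewrite subrr expr0n. Qed.

Lemma coord_sqdist y v j : (v ord0 j - y ord0 j) ^+ 2 <= sqdist y v.
Proof.
rewrite /sqdist (bigD1 j)//= lerDl; apply: sumr_ge0 => k _; exact: sqr_ge0.
Qed.

Lemma sqdist_le y v : sqdist y v <= 4 * `|v - y| ^+ 2.
Proof.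
rewrite /sqdist; apply: (@le_trans _ _ (\sum_(j < 4) `|v - y| ^+ 2)).
  apply: ler_sum => j _; rewrite -real_normK ?num_real// lerXn2r ?nnegrE//.
  by have := coord_norm_le (v - y) j; rewrite !mxE.
by rewrite sumr_const card_ord mulr_natl.
Qed.

Lemma norm_le_sqdist y v (r : R) : 0 <= r -> sqdist y v <= r ^+ 2 -> `|v - y| <= r.
Proof.
move=> r0 H; apply: norm_le_coord => // j; rewrite !mxE.
rewrite -(ler_pXn2r (_ : 0 < 2)%N) ?nnegrE// real_normK ?num_real//.
exact: le_trans (coord_sqdist _ _ _) H.
Qed.

Lemma sqdist_line y v i (t : R) : sqdist y (v + t *: bas i) =
  sqdist y v + (2 * (v ord0 i - y ord0 i) * t + t ^+ 2).
Proof.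
rewrite /sqdist (bigD1 i)//= [in RHS](bigD1 i)//= !mxE !eqxx /=.
rewrite (eq_bigr (fun j => (v ord0 j - y ord0 j) ^+ 2)); last first.
  by move=> j /negbTE ji; rewrite !mxE ji andbF mulr0 addr0.
by ring.
Qed.

Lemma coord_cts j v : {for v, continuous (fun w : V => w ord0 j)}.
Proof. exact: coord_continuous. Qed.

Lemma sqdist_cts y v : {for v, continuous (sqdist y)}.
Proof.
apply: cts_sum => j; apply: ctsX; apply: ctsB; first exact: coord_cts.
exact: cts_cst.
Qed.

(** The barrier is [|v - y|^-4]. In R^4 the Laplacian of [|v|^-s] is [s (s - 2) |v|^(-s-2)]; the
    exponent 4 exceeds that of the fundamental solution, 2, so the result is strictly positive. *)
Lemma barrier_laplacian y : has_laplacian [set v | v != y]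
  (fun v => (sqdist y v ^+ 2)^-1) (fun v => 8 * (sqdist y v ^+ 3)^-1).
Proof.
exists (fun i v => - 4 * ((v ord0 i - y ord0 i) * (sqdist y v ^+ 3)^-1)).
exists (fun i v => - 4 * (sqdist y v ^+ 3)^-1 +
   24 * (v ord0 i - y ord0 i) ^+ 2 * (sqdist y v ^+ 4)^-1).
move=> v /= vy.
have N0 : sqdist y v != 0.
  by apply: contra_neq vy; exact: sqdist_eq0.
pose N := sqdist y v.
have dN i : der (fun t => sqdist y (v + t *: bas i)) 0 (2 * (v ord0 i - y ord0 i)).
  rewrite (_ : (fun t => _) = fun t =>
      N + (2 * (v ord0 i - y ord0 i) * t + t ^+ 2)); last first.
    by apply/funext => t; rewrite sqdist_line.
  apply: der_eq (derD (der_cst N 0) (derD (derMl _ (der_id 0)) (der_sqr (der_id 0)))) _.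
  by rewrite !(mulr0, mul0r, mulr1, add0r, addr0).
have v0 i : v + 0 *: bas i = v by rewrite scale0r addr0.
split => [i|i|].
- apply: der_eq (derV _ (der_sqr (dN i))) _; rewrite !v0 ?expf_neq0//.
  by rewrite -/N; field.
- have dc : der (fun t : R => (v + t *: bas i) ord0 i - y ord0 i) 0 1.
    rewrite (_ : (fun t => _) = fun t => (v ord0 i - y ord0 i) + t); last first.
      by apply/funext => t; rewrite !mxE !eqxx /=; ring.
    by apply: der_eq (derD (der_cst _ _) (der_id _)) _; rewrite add0r.
  have d3 : der (fun t : R => sqdist y (v + t *: bas i) ^+ 3) 0
      (3 * N ^+ 2 * (2 * (v ord0 i - y ord0 i))).
    rewrite (_ : (fun t => _) = fun t => sqdist y (v + t *: bas i) ^+ 2 *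
        sqdist y (v + t *: bas i)); last by apply/funext => t; rewrite -exprSr.
    by apply: der_eq (derM (der_sqr (dN i)) (dN i)) _; rewrite !v0 -/N; ring.
  apply: der_eq (derMl _ (derM dc (derV _ d3))) _; rewrite !v0 ?expf_neq0//.
  by rewrite -/N; field.
- rewrite big_split /= sumr_const card_ord -mulr_suml -mulr_sumr -/(sqdist y v) -/N.
  by rewrite -mulr_natl; field.
Qed.

(** The approximant may depend on the cube as well as on the accuracy. Harmonicity is asked inside
    the cube and continuity up to its boundary, as [maximum_principle] requires. *)
Definition harmonic_limit (A : set V) s := forall z (r eta : R), 0 < r -> 0 < eta ->
  (forall v, `|v - z| <= r -> A v) ->
  exists T, [/\ has_laplacian [set v | `|v - z| < r] T (fun=> 0),
    forall v, `|v - z| <= r -> {for v, continuous T}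
    & forall v, `|v - z| <= r -> `|T v - s v| <= eta].

Lemma compact_ub (K : set V) s : compact K ->
  (forall v, K v -> {for v, continuous s}) -> exists k, forall v, K v -> s v <= k.
Proof.
move=> cK cs; have [K0|/set0P/negP/negPn/eqP K0] := pselect (K !=set0); last first.
  by exists 0 => v; rewrite K0.
have [|c _ cm] := compact_EVT_max (f := s) K0 cK.
  by apply/continuous_in_subspaceT => w /set_mem; exact: cs.
by exists (s c) => v Kv; apply: cm; rewrite inE.
Qed.

Lemma compact_lt_ub (K : set V) s (M : R) : compact K ->
  (forall v, K v -> {for v, continuous s}) -> (forall v, K v -> s v < M) ->
  exists2 k, k < M & forall v, K v -> s v <= k.
Proof.
move=> cK cs sM; have [K0|/set0P/negP/negPn/eqP K0] := pselect (K !=set0); last first.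
  by exists (M - 1); [rewrite ltrBlDr ltrDl|move=> v; rewrite K0].
have [|c /set_mem Kc cm] := compact_EVT_max (f := s) K0 cK.
  by apply/continuous_in_subspaceT => w /set_mem; exact: cs.
by exists (s c); [exact: sM|move=> v Kv; apply: cm; rewrite inE].
Qed.

(* Hopf's argument: if s q < M, the Euclidean ball with diameter [q, z0], z0 a nearest
   point of {s = M}, meets {s = M} in z0 only; then s + delta * barrier violates
   [maximum_principle] on a small cube around z0. *)
Lemma strong_maximum s p (r0 : R) : 0 < r0 ->
  (forall v, `|v - p| < r0 -> {for v, continuous s}) ->
  harmonic_limit [set v | `|v - p| < r0] s ->
  (forall v, `|v - p| < r0 -> s v <= s p) ->
  forall v, `|v - p| < r0 / 16 -> s v = s p.
Proof.
move=> r00 cs hs sp q qp; apply/eqP; rewrite eq_le sp /=; last by lra.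
rewrite leNgt; apply/negP => sq.
pose Z := [set v | `|v - p| <= r0 / 2] `&` [set v | s v = s p].
have in0 v : `|v - p| <= r0 / 2 -> `|v - p| < r0 by move=> ?; lra.
have cZ : compact Z.
  apply: (subclosed_compact _ (@cball_compact p (r0 / 2))); last by move=> v [].
  move=> v vZ.
  have vp : `|v - p| <= r0 / 2.
    have cl : closed [set v | `|v - p| <= r0 / 2].
      by apply: closed_le_preimage => w; exact: norm_sub_cts.
    by apply: cl; apply: closure_subset vZ => w [].
  split => //=; apply/eqP; rewrite -subr_eq0 -normr_eq0 eq_le normr_ge0 andbT.
  rewrite leNgt; apply/negP => e0.
  have /ctsP /(_ _ e0) nv := cs v (in0 v vp).
  by have [w [[_ /= ->]]] := vZ _ nv; rewrite ltxx.
have Zp : Z p by split => //=; rewrite subrr normr0; lra.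
have [||z /set_mem [/= zp sz] zmin] := compact_EVT_min (f := sqdist q) _ cZ.
- by exists p.
- by apply/continuous_in_subspaceT => w _; exact: sqdist_cts.
have {}zmin v : Z v -> sqdist q z <= sqdist q v by move=> Zv; apply: zmin; rewrite inE.
(* Since [p] itself lies in [Z], [sqdist q z <= sqdist q p <= 4 (r0/16)^2 = (r0/8)^2]. *)
have zq : `|z - q| <= r0 / 8.
  apply: norm_le_sqdist; first by lra.
  apply: le_trans (zmin p Zp) _; apply: le_trans (sqdist_le _ _) _.
  have := normr_ge0 (p - q); move: qp; rewrite distrC; set n := `|p - q| => *.
  by nra.
have zp' : `|z - p| <= 3 * r0 / 16.
  have := ler_normD (z - q) (q - p); rewrite subrKA; lra.
pose D := sqdist q z.
have D0 : 0 < D.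
  rewrite lt_neqAle sqdist_ge0 andbT eq_sym; apply/eqP => /sqdist_eq0 zqE.
  by move: sq; rewrite -zqE sz ltxx.
have sZ v : `|v - p| <= r0 / 2 -> sqdist q v < D -> s v < s p.
  move=> vp vD; rewrite lt_neqAle sp ?in0// andbT; apply/eqP => sv.
  by move: vD; rewrite ltNge zmin.
(* The centre of Hopf's ball. The median formula [par] shows that every point of that ball other
   than [z] is strictly closer to [q] than [z] is, hence is not in [Z]. *)
pose y : V := 2^-1 *: (q + z).
have par v : sqdist q v + sqdist z v = 2 * sqdist y v + D / 2.
  rewrite /D /sqdist mulr_suml mulr_sumr -!big_split /=.
  by apply: eq_bigr => j _; rewrite !mxE; field.
have yz : sqdist y z = D / 4.
  by have := par z; rewrite sqdistxx -/D; lra.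
have zy : 0 < `|y - z|.
  rewrite normr_gt0 subr_eq0; apply/eqP => yzE.
  by move: yz; rewrite yzE sqdistxx; lra.
(* The first bound keeps the cube around [z] away from the pole [y] of the barrier, the second keeps
   it within [r0 / 2] of [p]. *)
have [r r_gt0 [ry rr0]] : exists2 r : R, 0 < r & r < `|y - z| /\ r <= r0 / 8.
  exists (Num.min (`|y - z| / 2) (r0 / 8)); first by rewrite lt_min; apply/andP; split; lra.
  by split; [rewrite gt_min; apply/orP; left; lra|rewrite ge_min lexx orbT].
have vp v : `|v - z| <= r -> `|v - p| <= r0 / 2.
  by have := ler_normD (v - z) (z - p); rewrite subrKA => *; lra.
have vy v : `|v - z| <= r -> v != y.
  by move=> vr; apply: contraTneq vr => ->; rewrite -ltNge.
have phi_cts v : `|v - z| <= r -> {for v, continuous (fun v => (sqdist y v ^+ 2)^-1)}.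
  move=> vr; apply: ctsV; last by apply: ctsX; exact: sqdist_cts.
  by rewrite expf_neq0//; apply: contra_neq (vy v vr); exact: sqdist_eq0.
have cbd : compact [set v | `|v - z| = r].
  rewrite (_ : mkset _ = [set v | `|v - z| <= r] `&` [set v | - `|v - z| <= - r]).
    apply: compact_closedI; first exact: cball_compact.
    by apply: closed_le_preimage => v; exact: (ctsN (@norm_sub_cts z v)).
  apply/seteqP; split => v /=; first by move=> ->; rewrite !lexx.
  by case=> a b; apply/eqP; rewrite eq_le a /= -lerN2.
(* The barrier normalised to vanish on the sphere of Hopf's ball, in particular at [z]; it is
   negative outside. On the part [K] of the cube's boundary inside the ball, [s] stays below
   [m < s p], which leaves room for a small positive multiple of [phi]. *)
pose phi v := (sqdist y v ^+ 2)^-1 - ((D / 4) ^+ 2)^-1.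
have cphi v : `|v - z| <= r -> {for v, continuous phi}.
  by move=> vr; apply: ctsB; [exact: phi_cts|exact: cts_cst].
pose K := [set v | `|v - z| = r] `&` [set v | sqdist y v <= D / 4].
have cK : compact K.
  apply: compact_closedI => //; apply: closed_le_preimage => v; exact: sqdist_cts.
have Kr v : K v -> `|v - z| <= r by case => /= ->.
have [m mM Km] : exists2 m, m < s p & forall v, K v -> s v <= m.
  apply: compact_lt_ub => // v Kv; first by apply: cs; apply/in0/vp/Kr.
  apply: sZ; first exact/vp/Kr.
  have zv : 0 < sqdist z v.
    rewrite lt_neqAle sqdist_ge0 andbT eq_sym; apply/eqP => /sqdist_eq0 vzE.
    by case: Kv => /=; rewrite vzE subrr normr0 => r0'; move: r_gt0; rewrite -r0' ltxx.
  by have := par v; case: Kv => /= _; lra.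
have [k Kk] : exists k, forall v, K v -> phi v <= k.
  by apply: compact_ub => // v /Kr; exact: cphi.
pose delta := (s p - m) / (2 * (`|k| + 1)).
have k1 : 0 < `|k| + 1 by rewrite ltr_wpDl.
have delta0 : 0 < delta by rewrite divr_gt0 ?mulr_gt0// subr_gt0.
have [mu muM bdmu] : exists2 mu, mu < s p &
    forall v, [set v | `|v - z| = r] v -> s v + delta * phi v <= mu.
  apply: compact_lt_ub => //= v vr.
    have vr' : `|v - z| <= r by rewrite vr.
    apply: ctsD; first by apply: cs; exact/in0/vp.
    by apply: ctsM; [exact: cts_cst|exact: cphi].
  have vr' : `|v - z| <= r by rewrite vr.
  have [vD|vD] := leP (sqdist y v) (D / 4).
    have Kv : K v by [].
    have dk : delta * phi v <= (s p - m) / 2.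
      apply: (@le_trans _ _ (delta * (`|k| + 1))).
        rewrite ler_pM2l//; apply: le_trans (Kk v Kv) _.
        by apply: le_trans (ler_norm _) _; rewrite lerDl.
      by rewrite le_eqVlt; apply/orP; left; apply/eqP; rewrite /delta; field;
        rewrite lt0r_neq0.
    by have := Km v Kv; lra.
  have phi0 : phi v < 0.
    rewrite subr_lt0 ltf_pV2 ?posrE ?exprn_gt0 ?ltrXn2r ?divr_ge0 ?ltW//; lra.
  by have := sp v (in0 _ (vp v vr')); nra.
(* The error enters twice, at [z] and at the boundary point [w]; two thirds of the gap [s p - mu]
   still leave a contradiction. *)
have [T [hT cT Ts]] := hs z r ((s p - mu) / 3) r_gt0 ltac:(lra) (fun v vr => in0 v (vp v vr)).
have lap : has_laplacian [set v | `|v - z| < r]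
    (fun v => T v + delta * (sqdist y v ^+ 2)^-1)
    (fun v => 0 + delta * (8 * (sqdist y v ^+ 3)^-1)).
  apply: has_laplacianD => //; apply: has_laplacianZ.
  by apply: has_laplacian_sub (barrier_laplacian y) => v /= /ltW; exact: vy.
have zr : `|z - z| <= r by rewrite subrr normr0 ltW.
have [||w wr] := maximum_principle r_gt0 lap _ _ zr.
- move=> v /ltW/vy v_y; rewrite add0r mulr_gt0// mulr_gt0// invr_gt0 exprn_gt0//.
  rewrite lt_neqAle sqdist_ge0 andbT eq_sym.
  by apply: contra_neq v_y; exact: sqdist_eq0.
- by move=> v vr; apply: ctsD; [exact: cT|apply: ctsM; [exact: cts_cst|exact: phi_cts]].
have := bdmu w wr; rewrite /phi yz.
have := Ts z zr; have := Ts w; rewrite wr lexx => /(_ isT).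
rewrite !ler_norml => /andP[? ?] /andP[? ?] ? ?.
move: sz => ?; lra.
Qed.

End StrongMaximum.

(** * Unique continuation for Cauchy-Riemann pairs *)

Section UniqueContinuation.
Variable R : realType.

(* exp(lambda / |z - z0|^2) is a Carleman-type weight: 1 / |z - z0|^2 is radially
   decreasing and strictly subharmonic, so |h + ik|^2 times the weight has no positive
   interior maximum. *)
Lemma cauchy_riemann_weighted_max (h k A B al be : R -> R -> R) (a b r x y la : R) :
  0 < la -> (x - a) ^+ 2 + (y - b) ^+ 2 != 0 -> 0 < r ->
  (forall x' y', `|x' - x| < r -> `|y' - y| < r ->
    [/\ der (h ^~ y') x' (- A x' y'), der (h x') y' (B x' y'),
        der (k ^~ y') x' (- B x' y') & der (k x') y' (- A x' y')]) ->
  [/\ der (A ^~ y) x (al x y), der (A x) y (be x y),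
      der (B ^~ y) x (- be x y) & der (B x) y (al x y)] ->
  (forall x' y', `|x' - x| < r -> `|y' - y| < r ->
    (h x' y' ^+ 2 + k x' y' ^+ 2) * expR (la / ((x' - a) ^+ 2 + (y' - b) ^+ 2)) <=
    (h x y ^+ 2 + k x y ^+ 2) * expR (la / ((x - a) ^+ 2 + (y - b) ^+ 2))) ->
  h x y ^+ 2 + k x y ^+ 2 = 0.
Proof.
move=> la0; set qq := (x - a) ^+ 2 + (y - b) ^+ 2 => q0 r0 H1 [Ax Ay Bx By] Wmax.
pose W (x y : R) := h x y ^+ 2 + k x y ^+ 2.
pose q (x y : R) := (x - a) ^+ 2 + (y - b) ^+ 2.
have qE : q x y = qq by [].
apply/eqP; rewrite eq_le addr_ge0 ?sqr_ge0// andbT leNgt; apply/negP => W0.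
have {}W0 : 0 < W x y by [].
have qp : 0 < qq by rewrite lt_neqAle eq_sym q0 addr_ge0 ?sqr_ge0.
have [s s0 sr] : exists2 s : R, 0 < s & forall x' y', `|x' - x| < s -> `|y' - y| < s ->
    [/\ `|x' - x| < r, `|y' - y| < r & q x' y' != 0].
  have cq : cts2 q x y.
    have f1 : {for (x, y), continuous (fun z : R * R => z.1)} by exact: cvg_fst.
    have f2 : {for (x, y), continuous (fun z : R * R => z.2)} by exact: cvg_snd.
    by apply: ctsD; apply: ctsX; apply: ctsB => //; exact: cts_cst.
  have /cts2P /(_ _ qp)[s s0 sq] := cq.
  exists (Num.min r s); first by rewrite lt_min r0 s0.
  move=> x' y'; rewrite !lt_min => /andP[-> xs] /andP[-> ys]; split => //.
  have := sq _ _ xs ys; rewrite qE ltr_norml => /andP[u _].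
  by rewrite gt_eqF//; lra.
have ss (t : R) : `|t - t| < s by rewrite subrr normr0.
have [h1 h2 h3 h4] : [/\ der (h ^~ y) x (- A x y), der (h x) y (B x y),
    der (k ^~ y) x (- B x y) & der (k x) y (- A x y)].
  by have [? ? ?] := sr _ _ (ss x) (ss y); exact: H1.
have qx (x' y' : R) : der (q ^~ y') x' (2 * (x' - a)).
  apply: der_eq (derD (der_sqr (derB (der_id x') (der_cst a x')))
    (der_cst ((y' - b) ^+ 2) x')) _; ring.
have qy (x' y' : R) : der (q x') y' (2 * (y' - b)).
  apply: der_eq (derD (der_cst ((x' - a) ^+ 2) y')
    (der_sqr (derB (der_id y') (der_cst b y')))) _; ring.
pose om (x y : R) := expR (la / q x y).
have omx (x' y' : R) : q x' y' != 0 ->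
    der (om ^~ y') x' (om x' y' * (- 2 * la * (x' - a) / q x' y' ^+ 2)).
  move=> qn; have dq := derMl la (@derV _ (q ^~ y') x' _ qn (qx x' y')).
  have de : der expR (la / q x' y') (expR (la / q x' y')) by exact: is_derive_expR.
  by apply: der_eq (@der_comp _ expR (fun t => la / q t y') x' _ _ de dq) _; rewrite /om; field.
have omy (x' y' : R) : q x' y' != 0 ->
    der (om x') y' (om x' y' * (- 2 * la * (y' - b) / q x' y' ^+ 2)).
  move=> qn; have dq := derMl la (@derV _ (q x') y' _ qn (qy x' y')).
  have de : der expR (la / q x' y') (expR (la / q x' y')) by exact: is_derive_expR.
  by apply: der_eq (@der_comp _ expR (fun t => la / q x' t) y' _ _ de dq) _; rewrite /om; field.
(* [sg] and [ta] are the logarithmic derivatives of the weight [om] in [x] and [y]. *)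
pose sg (x y : R) := - 2 * la * (x - a) / q x y ^+ 2.
pose ta (x y : R) := - 2 * la * (y - b) / q x y ^+ 2.
have sgx : der (sg ^~ y) x (- 2 * la / qq ^+ 2 + 8 * la * (x - a) ^+ 2 / qq ^+ 3).
  apply: der_eq (derM (derMl (- 2 * la) (derB (der_id x) (der_cst a x)))
    (derV _ (der_sqr (qx x y)))) _; rewrite ?qE ?expf_neq0//.
  by field.
have tay : der (ta x) y (- 2 * la / qq ^+ 2 + 8 * la * (y - b) ^+ 2 / qq ^+ 3).
  apply: der_eq (derM (derMl (- 2 * la) (derB (der_id y) (der_cst b y)))
    (derV _ (der_sqr (qy x y)))) _; rewrite ?qE ?expf_neq0//.
  by field.
pose Wx (x y : R) := - 2 * (h x y * A x y + k x y * B x y).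
pose Wy (x y : R) := 2 * (h x y * B x y - k x y * A x y).
have dWx x' y' : `|x' - x| < s -> `|y' - y| < s -> der (W ^~ y') x' (Wx x' y').
  move=> xs ys; have [xr yr _] := sr _ _ xs ys; have [d1 _ d2 _] := H1 _ _ xr yr.
  by apply: der_eq (derD (der_sqr d1) (der_sqr d2)) _; rewrite /Wx; ring.
have dWy x' y' : `|x' - x| < s -> `|y' - y| < s -> der (W x') y' (Wy x' y').
  move=> xs ys; have [xr yr _] := sr _ _ xs ys; have [_ d1 _ d2] := H1 _ _ xr yr.
  by apply: der_eq (derD (der_sqr d1) (der_sqr d2)) _; rewrite /Wy; ring.
have dWxx : der (Wx ^~ y) x
    (2 * (A x y ^+ 2 + B x y ^+ 2) - 2 * (h x y * al x y - k x y * be x y)).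
  by apply: der_eq (derMl (- 2) (derD (derM h1 Ax) (derM h3 Bx))) _; ring.
have dWyy : der (Wy x) y
    (2 * (A x y ^+ 2 + B x y ^+ 2) + 2 * (h x y * al x y - k x y * be x y)).
  by apply: der_eq (derMl 2 (derB (derM h2 By) (derM h4 Ay))) _; ring.
have om0 : 0 < om x y by exact: expR_gt0.
pose fx t := om t y * (Wx t y + W t y * sg t y).
pose fy t := om x t * (Wy x t + W x t * ta x t).
have dfx t : `|t - x| < s -> der (fun t => W t y * om t y) t (fx t).
  move=> ts; have [_ _ qt] := sr _ _ ts (ss y).
  by apply: der_eq (derM (dWx _ _ ts (ss y)) (omx t y qt)) _; rewrite /fx /sg; ring.
have dfy t : `|t - y| < s -> der (fun t => W x t * om x t) t (fy t).
  move=> ts; have [_ _ qt] := sr _ _ (ss x) ts.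
  by apply: der_eq (derM (dWy _ _ (ss x) ts) (omy x t qt)) _; rewrite /fy /ta; ring.
have mx t : `|t - x| < s -> W t y * om t y <= W x y * om x y.
  by move=> ts; have [? ? _] := sr _ _ ts (ss y); exact: Wmax.
have my t : `|t - y| < s -> W x t * om x t <= W x y * om x y.
  by move=> ts; have [? ? _] := sr _ _ (ss x) ts; exact: Wmax.
have fx0 : fx x = 0.
  apply: (max_der0 s0 _ mx (dfx x (ss x))) => t /dfx; by exists (fx t).
have fy0 : fy y = 0.
  apply: (max_der0 s0 _ my (dfy y (ss y))) => t /dfy; by exists (fy t).
have ex : Wx x y = - (W x y * sg x y).
  by move/eqP: fx0; rewrite mulf_eq0 gt_eqF//= addr_eq0 => /eqP.
have ey : Wy x y = - (W x y * ta x y).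
  by move/eqP: fy0; rewrite mulf_eq0 gt_eqF//= addr_eq0 => /eqP.
have qn : q x y != 0 by rewrite qE.
have := second_derivative_test s0 dfx mx
  (derM (omx x y qn) (derD dWxx (derM (dWx _ _ (ss x) (ss y)) sgx))).
have := second_derivative_test s0 dfy my
  (derM (omy x y qn) (derD dWyy (derM (dWy _ _ (ss x) (ss y)) tay))).
rewrite -/(sg x y) -/(ta x y).
rewrite ex ey !addNr !mul0r !addr0 !pmulr_rle0//.
(* This is [|grad W|^2 = 4 W |H'|^2] for [W = |H|^2], that is, harmonicity of [log W], combined with
   the critical point equations [ex] and [ey]. In the sum of the two second derivatives everything
   then cancels except [W] times the Laplacian of [la / q], which is the positive number [lap]. *)
have g : 4 * (A x y ^+ 2 + B x y ^+ 2) = W x y * (sg x y ^+ 2 + ta x y ^+ 2).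
  apply: (mulfI (lt0r_neq0 W0)).
  have -> : W x y * (W x y * (sg x y ^+ 2 + ta x y ^+ 2)) = Wx x y ^+ 2 + Wy x y ^+ 2.
    by rewrite ex ey; ring.
  by rewrite /W /Wx /Wy; ring.
have lap : 0 < (- 2 * la / qq ^+ 2 + 8 * la * (x - a) ^+ 2 / qq ^+ 3) +
    (- 2 * la / qq ^+ 2 + 8 * la * (y - b) ^+ 2 / qq ^+ 3).
  rewrite (_ : _ + _ = 4 * la / qq ^+ 2); first by rewrite divr_gt0 ?exprn_gt0 ?mulr_gt0.
  by rewrite /qq; field.
have := mulr_gt0 W0 lap; rewrite mulrDr.
by lra.
Qed.

(** The weight is singular at the centre, so it is maximised over the annulus [e^2/4 <= q <= rho],
    whose inner circle lies where [h] and [k] vanish. The weighted maximum is thus zero or on the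
    outer circle, which gives [key]; as [q x1 y1 < rho], a large [la] forces [W x1 y1 = 0]. *)
Lemma cauchy_riemann_unique_continuation (h k A B al be : R -> R -> R) (a b r e : R) :
  0 < r -> 0 < e ->
  (forall x y, `|x - a| < r -> `|y - b| < r ->
    [/\ der (h ^~ y) x (- A x y), der (h x) y (B x y),
        der (k ^~ y) x (- B x y) & der (k x) y (- A x y)]) ->
  (forall x y, `|x - a| < r -> `|y - b| < r ->
    [/\ der (A ^~ y) x (al x y), der (A x) y (be x y),
      der (B ^~ y) x (- be x y) & der (B x) y (al x y)]) ->
  (forall x y, `|x - a| < r -> `|y - b| < r -> cts2 h x y /\ cts2 k x y) ->
  (forall x y, `|x - a| < e -> `|y - b| < e -> h x y = 0 /\ k x y = 0) ->
  forall x y, (x - a) ^+ 2 + (y - b) ^+ 2 < r ^+ 2 -> h x y = 0 /\ k x y = 0.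
Proof.
move=> r0 e0 H1 H2 H3 H4 x1 y1 q1r.
pose q (x y : R) := (x - a) ^+ 2 + (y - b) ^+ 2.
pose W (x y : R) := h x y ^+ 2 + k x y ^+ 2.
suff W0 : W x1 y1 <= 0.
  have := sqr_ge0 (h x1 y1); have := sqr_ge0 (k x1 y1) => k0 h0.
  have : W x1 y1 == 0 by rewrite eq_le W0 addr_ge0.
  by rewrite paddr_eq0// !sqrf_eq0 => /andP[/eqP -> /eqP ->].
have W_ge0 x y : 0 <= W x y by rewrite addr_ge0 ?sqr_ge0.
have near_q (d x y : R) : 0 < d -> q x y < d ^+ 2 -> `|x - a| < d /\ `|y - b| < d.
  have sq (u : R) : 0 < d -> u ^+ 2 < d ^+ 2 -> `|u| < d.
    move=> d0 ud; rewrite -(ltr_pXn2r (_ : 0 < 2)%N) ?nnegrE ?(ltW d0)//.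
    by rewrite real_normK ?num_real.
  move=> d0 qd; have := sqr_ge0 (x - a); have := sqr_ge0 (y - b).
  by split; apply: sq => //; move: qd; rewrite /q; lra.
have {}q1r : q x1 y1 < r ^+ 2 by [].
have [q1e|q1e] := ltP (q x1 y1) (e ^+ 2).
  have [xe ye] := near_q _ _ _ e0 q1e.
  by have [h0 k0] := H4 _ _ xe ye; rewrite /W h0 k0 expr0n addr0.
have q10 : 0 < q x1 y1 by apply: lt_le_trans q1e; rewrite exprn_gt0.
pose rho := (q x1 y1 + r ^+ 2) / 2.
have q1rho : q x1 y1 < rho by rewrite /rho; lra.
have rhor : rho < r ^+ 2 by rewrite /rho; lra.
pose K := (`[a - r, a + r]%classic `*` `[b - r, b + r]%classic) `&`
   ([set z : R * R | q z.1 z.2 <= rho] `&` [set z : R * R | e ^+ 2 / 4 <= q z.1 z.2]).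
have cq (z : R * R) : {for z, continuous (fun z : R * R => q z.1 z.2)}.
  have f1 : {for z, continuous (fun z : R * R => z.1)} by exact: cvg_fst.
  have f2 : {for z, continuous (fun z : R * R => z.2)} by exact: cvg_snd.
  by apply: ctsD; apply: ctsX; apply: ctsB => //; exact: cts_cst.
have cK : compact K.
  apply: compact_closedI; first by apply: compact_setX; exact: segment_compact.
  apply: closedI.
    apply: (@closed_comp _ _ (fun z : R * R => q z.1 z.2) [set x : R | x <= rho]).
      by move=> z _; exact: cq.
    exact: closed_le.
  apply: (@closed_comp _ _ (fun z : R * R => q z.1 z.2) [set x : R | e ^+ 2 / 4 <= x]).
    by move=> z _; exact: cq.
  exact: closed_ge.
have rect (x y : R) : q x y <= rho -> `|x - a| < r /\ `|y - b| < r.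
  by move=> /le_lt_trans /(_ rhor); exact: near_q.
have KP (x y : R) : q x y <= rho -> e ^+ 2 / 4 <= q x y -> K (x, y).
  move=> qr qe; have [xr yr] := rect _ _ qr.
  by split; [rewrite /= !in_itv /= -!ler_distl !ltW|].
have K1 : K (x1, y1) by apply: KP; [exact: ltW|rewrite -/(q x1 y1); lra].
have cW x y : `|x - a| < r -> `|y - b| < r -> cts2 W x y.
  by move=> xr yr; have [ch ck] := H3 x y xr yr; apply: ctsD; exact: ctsX.
have WK : {within K, continuous (fun z : R * R => W z.1 z.2)}.
  apply/continuous_in_subspaceT => -[x y] /set_mem [_ [/= qr _]].
  by have [xr yr] := rect _ _ qr; exact: cW.
have [[xm ym] _ WM] := compact_EVT_max (ex_intro _ _ K1) cK WK.
set M := W _ _ in WM.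
have {}WM x y : K (x, y) -> W x y <= M by move=> Kxy; apply: (WM (x, y)); rewrite inE.
have key la : 0 < la -> W x1 y1 * expR (la / q x1 y1) <= M * expR (la / rho).
  move=> la0.
  have ZK : {within K, continuous (fun z : R * R => W z.1 z.2 * expR (la / q z.1 z.2))}.
    apply/continuous_in_subspaceT => -[x y] /set_mem [_ [/= qr qe]].
    have [xr yr] := rect _ _ qr.
    apply: (@ctsM _ _ (fun z : R * R => W z.1 z.2)
      (fun z : R * R => expR (la / q z.1 z.2))); first exact: cW.
    apply: (@cts_comp _ _ expR (fun z : R * R => la / q z.1 z.2)).
      exact: continuous_expR.
    apply: ctsM; first exact: cts_cst.
    apply: ctsV; last exact: cq.
    have e2 : 0 < e ^+ 2 by rewrite exprn_gt0.
    by rewrite gt_eqF//=; lra.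
  have [[x y] /set_mem Kxy Zmax] := compact_EVT_max (ex_intro _ _ K1) cK ZK.
  have {}Zmax x' y' : K (x', y') ->
      W x' y' * expR (la / q x' y') <= W x y * expR (la / q x y).
    by move=> Kxy'; apply: (Zmax (x', y')); rewrite inE.
  apply: le_trans (Zmax _ _ K1) _; have [_ [/= qr qe]] := Kxy.
  have M0 : 0 <= M by exact: le_trans (W_ge0 _ _) (WM _ _ Kxy).
  suff [W0|qE] : W x y = 0 \/ q x y = rho.
  - by rewrite W0 mul0r mulr_ge0// expR_ge0.
  - by rewrite qE ler_pM2r ?expR_gt0// WM.
  have [qE|/eqP qN] := eqVneq (q x y) rho; first by right.
  left; have [qe'|qe'] := ltP (q x y) (e ^+ 2).
    have [xe ye] := near_q _ _ _ e0 qe'.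
    by have [h0 k0] := H4 _ _ xe ye; rewrite /W h0 k0 expr0n addr0.
  have qr' : q x y < rho by rewrite lt_neqAle qr andbT; apply/eqP.
  have q0 : 0 < q x y by apply: lt_le_trans qe'; rewrite exprn_gt0.
  have e2 : 0 < e ^+ 2 by rewrite exprn_gt0.
  have [s s0 Ks] : exists2 s : R, 0 < s & forall x' y', `|x' - x| < s -> `|y' - y| < s ->
      q x' y' <= rho /\ e ^+ 2 / 4 <= q x' y'.
    have d0 : 0 < Num.min (rho - q x y) (q x y / 2).
      by rewrite lt_min subr_gt0 qr' divr_gt0.
    have /cts2P /(_ _ d0)[s s0 sP] := cq (x, y).
    exists s => // x' y' xs ys; have := sP _ _ xs ys.
    rewrite lt_min !ltr_norml => /andP[/andP[_ u1] /andP[u2 _]].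
    by split; rewrite -/(q _ _) in u1 u2 *; lra.
  have rr x' y' : `|x' - x| < s -> `|y' - y| < s -> `|x' - a| < r /\ `|y' - b| < r.
    by move=> xs ys; have [qr'' _] := Ks _ _ xs ys; exact: rect.
  have ss (t : R) : `|t - t| < s by rewrite subrr normr0.
  have q_neq0 : (x - a) ^+ 2 + (y - b) ^+ 2 != 0 by rewrite gt_eqF.
  apply: (cauchy_riemann_weighted_max (A := A) (B := B) (al := al) (be := be)
    la0 q_neq0 s0).
  - by move=> x' y' xs ys; have [? ?] := rr _ _ xs ys; exact: H1.
  - by have [? ?] := rr _ _ (ss x) (ss y); exact: H2.
  - move=> x' y' xs ys; have [? ?] := Ks _ _ xs ys.
    by apply: (Zmax x' y'); exact: KP.
rewrite leNgt; apply/negP => W0.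
have M0 : 0 <= M by exact: le_trans (W_ge0 _ _) (WM _ _ K1).
pose ka := (q x1 y1)^-1 - rho^-1.
have ka0 : 0 < ka by rewrite subr_gt0 ltf_pV2 ?posrE//; lra.
have M1 : 0 < M by exact: lt_le_trans W0 (WM _ _ K1).
(* Chosen so that [W x1 y1 * (la * ka) = M]; then [exp(t) >= 1 + t] yields [W x1 y1 + M <= M]. *)
pose la := M / (W x1 y1 * ka).
have la0 : 0 < la by rewrite divr_gt0// mulr_gt0.
have := key la la0.
have -> : la / q x1 y1 = la * ka + la / rho by rewrite /ka mulrBr subrK.
rewrite expRD mulrA ler_pM2r ?expR_gt0//.
have laka : W x1 y1 * (la * ka) = M by rewrite /la; field; rewrite !lt0r_neq0.
have := expR_ge1Dx (la * ka); nra.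
Qed.

End UniqueContinuation.

(** * The planar system for the stem components *)

Section StemSystem.
Variable R : realType.
Implicit Types (D : set (R * R)) (U V Ux Vx Vy c : R -> R -> R).

(* The restriction of the Fueter system to stem components; the derivative of U in the
   second variable is -Vx.  At y = 0 the equation U_x = V_y + 2 V / y degenerates to
   U_x = 3 V_y. *)
Record stem_system D U V Ux Vx Vy : Prop := StemSystem {
  stem_Ux : forall x y, D (x, y) -> der (U ^~ y) x (Ux x y);
  stem_Uy : forall x y, D (x, y) -> der (U x) y (- Vx x y);
  stem_Vx : forall x y, D (x, y) -> der (V ^~ y) x (Vx x y);
  stem_Vy : forall x y, D (x, y) -> der (V x) y (Vy x y);
  stem_cUx : forall x y, D (x, y) -> cts2 Ux x y;
  stem_cVx : forall x y, D (x, y) -> cts2 Vx x y;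
  stem_cVy : forall x y, D (x, y) -> cts2 Vy x y;
  stem_eq : forall x y, D (x, y) -> y * Ux x y = y * Vy x y + 2 * V x y;
  stem_eq0 : forall x, D (x, 0) -> Ux x 0 = 3 * Vy x 0;
  stem_odd : forall x y, D (x, y) -> V x (- y) = - V x y }.

Lemma open_box D (x y : R) : open D -> D (x, y) -> exists2 r : R, 0 < r &
  forall x' y', `|x' - x| <= r -> `|y' - y| <= r -> D (x', y').
Proof.
move=> oD Dxy; have /near2P[r r0 rD] : nbhs (x, y) D by exact: open_nbhs_nbhs.
exists (r / 2); first by rewrite divr_gt0.
by move=> x' y' xr yr; apply: rD; lra.
Qed.

Lemma cts2N U (x y : R) : cts2 U x y -> cts2 (fun x y => - U x y) x y.
Proof. by move=> cU; apply: ctsN. Qed.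

Lemma der0_cst (f : R -> R) (x r t : R) :
  (forall s, `|s - x| < r -> der f s 0) -> `|t - x| < r -> f t = f x.
Proof.
move=> fd tr; apply/eqP; rewrite -subr_eq0 -normr_le0.
have := @bounded_der_lip R f (fun=> 0) 0 r x t _ tr; rewrite mul0r; apply => s sr.
by split; [exact: fd|rewrite normr0].
Qed.

Section WithSystem.
Variables (D : set (R * R)) (U V Ux Vx Vy : R -> R -> R).
Hypothesis sys : stem_system D U V Ux Vx Vy.

Lemma stem_V0 (x : R) : D (x, 0) -> V x 0 = 0.
Proof. by move=> Dx; have := stem_eq sys Dx; rewrite !mul0r; lra. Qed.

Section Open.
Hypothesis oD : open D.

Lemma stem_cU (x y : R) : D (x, y) -> cts2 U x y.
Proof.
move=> Dxy; have [r r0 rD] := open_box oD Dxy.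
apply: (@partials_cts2 _ _ Ux (fun x y => - Vx x y) _ _ r) => //.
- move=> x' y' /ltW xr /ltW yr; have Dxy' := rD _ _ xr yr.
  by split; [exact: (stem_Ux sys)|exact: (stem_Uy sys)].
- exact: (stem_cUx sys).
- by apply: cts2N; exact: (stem_cVx sys).
Qed.

Lemma stem_cV (x y : R) : D (x, y) -> cts2 V x y.
Proof.
move=> Dxy; have [r r0 rD] := open_box oD Dxy.
apply: (@partials_cts2 _ _ Vx Vy _ _ r) => //.
- move=> x' y' /ltW xr /ltW yr; have Dxy' := rD _ _ xr yr.
  by split; [exact: (stem_Vx sys)|exact: (stem_Vy sys)].
- exact: (stem_cVx sys).
- exact: (stem_cVy sys).
Qed.

Section Box.
Variables (a b rho : R).
Hypothesis rho0 : 0 < rho.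
Hypothesis boxD : forall x y, `|x - a| <= rho -> `|y - b| <= rho -> D (x, y).

Lemma stem_potential : exists c, forall x y, `|x - a| < rho -> `|y - b| < rho ->
  der (c ^~ y) x (- U x y) /\ der (c x) y (V x y).
Proof.
have [x y xr yr|c cP] := @poincare R (fun x y => - U x y) V Vx
    (a - rho) (a + rho) (b - rho) (b + rho).
  have Dxy : D (x, y) by apply: boxD; rewrite ler_distl.
  split; first (by apply: cts2N; exact: stem_cU); first exact: stem_cV.
  - exact: (stem_cVx sys).
  - by apply: der_eq (derN (stem_Uy sys Dxy)) _; rewrite opprK.
  - exact: (stem_Vx sys).
by exists c => x y xr yr; apply: cP; rewrite -ltr_distl.
Qed.

Variable c : R -> R -> R.
Hypothesis cP : forall x y, `|x - a| < rho -> `|y - b| < rho ->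
  der (c ^~ y) x (- U x y) /\ der (c x) y (V x y).

Lemma potential_cts (x y : R) : `|x - a| < rho -> `|y - b| < rho -> cts2 c x y.
Proof.
move=> xr yr.
have Dxy : D (x, y) by apply: boxD; exact: ltW.
pose e := Num.min (rho - `|x - a|) (rho - `|y - b|).
have e0 : 0 < e by rewrite lt_min !subr_gt0 xr yr.
apply: (@partials_cts2 _ _ (fun x y => - U x y) V _ _ e) => //.
- move=> x' y'; rewrite !lt_min => /andP[x'e _] /andP[_ y'e]; apply: cP.
  + have := ler_normD (x' - x) (x - a); rewrite subrKA; lra.
  + have := ler_normD (y' - y) (y - b); rewrite subrKA; lra.
- by apply: cts2N; exact: stem_cU.
- exact: stem_cV.
Qed.

(** The oddness of [V] integrates to evenness of [c]. This lets [c x |t|] be replaced by [c x t]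
    when the radial function crosses the real axis. *)
Lemma potential_even (x y : R) : b = 0 -> `|x - a| < rho -> `|y| < rho ->
  c x (- y) = c x y.
Proof.
move=> b0 xr yr; move: boxD cP; rewrite b0 => boxD' cP'.
have y0 (t : R) : `|t - 0| < rho -> `|- t - 0| < rho by rewrite !subr0 normrN.
suff : c x y - c x (- y) = c x 0 - c x (- 0) by rewrite oppr0 subrr; lra.
apply: (@der0_cst (fun t => c x t - c x (- t)) 0 rho); last by rewrite subr0.
move=> s sr; have [_ d1] := cP' x s xr sr; have [_ d2] := cP' x (- s) xr (y0 s sr).
apply: der_eq (derB d1 (@der_comp _ (c x) (fun t => - t) s _ _ d2 (derN (der_id s)))) _.
rewrite (stem_odd sys); first by ring.
by apply: boxD'; exact: ltW.
Qed.

End Box.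

(** With [h = y c], the equation [stem_eq] is exactly closedness of the form defining the conjugate
    [k]. Both [c] and [k] are normalised to vanish at the centre, hence vanish near it.
    Differentiating [h = 0] returns [U] and [V] only where [y] is nonzero; on the axis [U] follows
    by continuity and [V] vanishes anyway. The radius is halved because [k] is built on a closed box
    inside the open one where [c] is differentiable. *)
Lemma stem_unique_continuation (a b rho e : R) : 0 < rho -> 0 < e ->
  (forall x y, `|x - a| <= rho -> `|y - b| <= rho -> D (x, y)) ->
  (forall x y, `|x - a| < e -> `|y - b| < e -> U x y = 0 /\ V x y = 0) ->
  forall x y, (x - a) ^+ 2 + (y - b) ^+ 2 < (rho / 2) ^+ 2 -> U x y = 0 /\ V x y = 0.
Proof.
move=> rho0 e0 boxD UV0.
have [c0 c0P] := stem_potential boxD.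
pose c x y := c0 x y - c0 a b.
have cP x y : `|x - a| < rho -> `|y - b| < rho ->
    der (c ^~ y) x (- U x y) /\ der (c x) y (V x y).
  move=> xr yr; have [d1 d2] := c0P x y xr yr.
  split; first by apply: der_eq (derB d1 (der_cst _ _)) _; rewrite subr0.
  by apply: der_eq (derB d2 (der_cst _ _)) _; rewrite subr0.
have cc x y := potential_cts boxD cP (x := x) (y := y).
have half (t s : R) : `|t - s| <= rho / 2 -> `|t - s| < rho by lra.
have [k0 k0P] : exists k, forall x y, a - rho / 2 < x < a + rho / 2 ->
    b - rho / 2 < y < b + rho / 2 ->
    der (k ^~ y) x (- (c x y + y * V x y)) /\ der (k x) y (- (y * U x y)).
  apply: (@poincare R _ _ (fun x y => - (2 * V x y + y * Vy x y))) => x y.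
  rewrite -!ler_distl => /half xr /half yr.
  have Dxy : D (x, y) by apply: boxD; exact: ltW.
  have [c1 c2] := cP x y xr yr.
  have cy : {for (x, y), continuous (fun z : R * R => z.2)} by exact: cvg_snd.
  have cV := stem_cV Dxy; have cU := stem_cU Dxy; have cVy := stem_cVy sys Dxy.
  split.
  - by apply: ctsN; apply: ctsD; [exact: cc|exact: ctsM].
  - by apply: ctsN; apply: ctsM.
  - by apply: ctsN; apply: ctsD; apply: ctsM => //; exact: cts_cst.
  - apply: der_eq (derN (derD c2 (derM (der_id y) (stem_Vy sys Dxy)))) _; ring.
  - apply: der_eq (derN (derMl y (stem_Ux sys Dxy))) _.
    by rewrite (stem_eq sys Dxy); ring.
pose k x y := k0 x y - k0 a b.
have r20 : 0 < rho / 2 by lra.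
have kP x y : `|x - a| < rho / 2 -> `|y - b| < rho / 2 ->
    der (k ^~ y) x (- (c x y + y * V x y)) /\ der (k x) y (- (y * U x y)).
  rewrite !ltr_distl => xr yr; have [d1 d2] := k0P x y xr yr.
  split; first by apply: der_eq (derB d1 (der_cst _ _)) _; rewrite subr0.
  by apply: der_eq (derB d2 (der_cst _ _)) _; rewrite subr0.
pose h x y := y * c x y.
have HP x y : `|x - a| < rho / 2 -> `|y - b| < rho / 2 ->
    [/\ der (h ^~ y) x (- (y * U x y)), der (h x) y (c x y + y * V x y),
        der (k ^~ y) x (- (c x y + y * V x y)) & der (k x) y (- (y * U x y))].
  move=> xr yr; have [d1 d2] := kP x y xr yr.
  have [c1 c2] := cP x y (half _ _ (ltW xr)) (half _ _ (ltW yr)).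
  split => //; first by apply: der_eq (derMl y c1) _; rewrite mulrN.
  by apply: der_eq (derM (der_id y) c2) _; ring.
have AP x y : `|x - a| < rho / 2 -> `|y - b| < rho / 2 ->
    [/\ der (fun x => y * U x y) x (y * Ux x y),
        der (fun y => y * U x y) y (U x y - y * Vx x y),
        der (fun x => c x y + y * V x y) x (- (U x y - y * Vx x y))
      & der (fun y => c x y + y * V x y) y (y * Ux x y)].
  move=> /ltW/half xr /ltW/half yr; have [c1 c2] := cP x y xr yr.
  have Dxy : D (x, y) by apply: boxD; exact: ltW.
  split; first exact: derMl (stem_Ux sys Dxy).
  - by apply: der_eq (derM (der_id y) (stem_Uy sys Dxy)) _; ring.
  - by apply: der_eq (derD c1 (derMl y (stem_Vx sys Dxy))) _; ring.
  - apply: der_eq (derD c2 (derM (der_id y) (stem_Vy sys Dxy))) _.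
    by rewrite (stem_eq sys Dxy); ring.
have ctsP x y : `|x - a| < rho / 2 -> `|y - b| < rho / 2 -> cts2 h x y /\ cts2 k x y.
  move=> xr yr.
  have cy : {for (x, y), continuous (fun z : R * R => z.2)} by exact: cvg_snd.
  have xr' := half _ _ (ltW xr); have yr' := half _ _ (ltW yr).
  have Dxy : D (x, y) by apply: boxD; exact: ltW.
  split; first by apply: ctsM => //; exact: cc.
  pose d := Num.min (rho / 2 - `|x - a|) (rho / 2 - `|y - b|).
  have d0 : 0 < d by rewrite lt_min !subr_gt0 xr yr.
  apply: (@partials_cts2 _ _ (fun x y => - (c x y + y * V x y))
    (fun x y => - (y * U x y)) _ _ d) => //.
  - move=> x' y'; rewrite !lt_min => /andP[x'e _] /andP[_ y'e]; apply: kP.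
    + have := ler_normD (x' - x) (x - a); rewrite subrKA; lra.
    + have := ler_normD (y' - y) (y - b); rewrite subrKA; lra.
  - by apply: ctsN; apply: ctsD; [exact: cc|apply: ctsM => //; exact: stem_cV].
  - by apply: ctsN; apply: ctsM => //; exact: stem_cU.
have z0 (t d : R) : 0 < d -> `|t - t| < d by rewrite subrr normr0.
pose e' := Num.min e (rho / 2).
have e'0 : 0 < e' by rewrite lt_min e0.
have zero x y : `|x - a| < e' -> `|y - b| < e' -> h x y = 0 /\ k x y = 0.
  have e'P (t : R) : t < e' -> t < e /\ t < rho / 2.
    by rewrite lt_min => /andP[].
  have c_0 x' y' : `|x' - a| < e' -> `|y' - b| < e' -> c x' y' = 0.
    move=> xe ye; rewrite (_ : 0 = c a b); last by rewrite /c subrr.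
    rewrite (@der0_cst (c ^~ y') a e' x')// => [|s se].
      apply: (@der0_cst (c a) b e') => // s se.
      have [s1 /ltW/half s2] := e'P _ se; have [a1 /ltW/half a2] := e'P _ (z0 a _ e'0).
      by have [_] := cP _ _ a2 s2; have [_ ->] := UV0 _ _ a1 s1.
    have [s1 /ltW/half s2] := e'P _ se; have [a1 /ltW/half a2] := e'P _ ye.
    by have [+ _] := cP _ _ s2 a2; have [-> _] := UV0 _ _ s1 a1; rewrite oppr0.
  move=> xe ye; split; first by rewrite /h c_0// mulr0.
  rewrite (_ : 0 = k a b); last by rewrite /k subrr.
  rewrite (@der0_cst (k ^~ y) a e' x)// => [|s se].
    apply: (@der0_cst (k a) b e') => // s se.
    have [s1 s2] := e'P _ se; have [a1 a2] := e'P _ (z0 a _ e'0).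
    have [_] := kP _ _ a2 s2; have [-> _] := UV0 _ _ a1 s1.
    by rewrite mulr0 oppr0.
  have [s1 s2] := e'P _ se; have [a1 a2] := e'P _ ye.
  have [+ _] := kP _ _ s2 a2; have [_ ->] := UV0 _ _ s1 a1.
  by rewrite c_0// mulr0 addr0 oppr0.
have hk0 := cauchy_riemann_unique_continuation r20 e'0 HP AP ctsP zero.
pose q (x y : R) := (x - a) ^+ 2 + (y - b) ^+ 2.
have near_q (x y : R) : q x y < (rho / 2) ^+ 2 -> `|x - a| < rho / 2 /\ `|y - b| < rho / 2.
  have sq (u : R) : u ^+ 2 < (rho / 2) ^+ 2 -> `|u| < rho / 2.
    move=> ud; rewrite -(ltr_pXn2r (_ : 0 < 2)%N) ?nnegrE ?(ltW r20)//.
    by rewrite real_normK ?num_real.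
  move=> qd; have := sqr_ge0 (x - a); have := sqr_ge0 (y - b).
  by split; apply: sq => //; move: qd; rewrite /q; lra.
have cq (z : R * R) : {for z, continuous (fun z : R * R => q z.1 z.2)}.
  have f1 : {for z, continuous (fun z : R * R => z.1)} by exact: cvg_fst.
  have f2 : {for z, continuous (fun z : R * R => z.2)} by exact: cvg_snd.
  by apply: ctsD; apply: ctsX; apply: ctsB => //; exact: cts_cst.
have near0 x y : q x y < (rho / 2) ^+ 2 -> exists2 d : R, 0 < d &
    forall x' y', `|x' - x| < d -> `|y' - y| < d -> q x' y' < (rho / 2) ^+ 2.
  move=> qr; have d0 : 0 < (rho / 2) ^+ 2 - q x y by rewrite subr_gt0.
  have /cts2P /(_ _ d0)[d d1 dP] := cq (x, y).
  by exists d => // x' y' xd yd; have := dP _ _ xd yd; rewrite ltr_norml; lra.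
have UV1 x y : q x y < (rho / 2) ^+ 2 -> y != 0 -> U x y = 0 /\ V x y = 0.
  move=> qr yn; have [xr yr] := near_q x y qr.
  have [d d0 dP] := near0 x y qr.
  have [h1 h2 _ _] := HP x y xr yr.
  have A0 : y * U x y = 0.
    suff : der (h ^~ y) x 0 by move/(der_unique h1)/eqP; rewrite oppr_eq0 => /eqP.
    apply: (@der_near _ (fun=> 0) _ _ _ _ (der_cst _ _)).
    apply/nbhs_ballP; exists d => // x'; rewrite /ball /= distrC => xd.
    by have [->] := hk0 x' y (dP _ _ xd (z0 y _ d0)).
  have B0 : c x y + y * V x y = 0.
    suff : der (h x) y 0 by move/(der_unique h2).
    apply: (@der_near _ (fun=> 0) _ _ _ _ (der_cst _ _)).
    apply/nbhs_ballP; exists d => // y'; rewrite /ball /= distrC => yd.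
    by have [->] := hk0 x y' (dP _ _ (z0 x _ d0) yd).
  have [/eqP h0 _] := hk0 x y qr; move: h0; rewrite mulf_eq0 (negbTE yn) /= => /eqP c_0.
  split; first by move/eqP: A0; rewrite mulf_eq0 (negbTE yn) => /eqP.
  by move/eqP: B0; rewrite c_0 add0r mulf_eq0 (negbTE yn) => /eqP.
move=> x y qr; have [y0|] := eqVneq y 0; last exact: UV1.
have [xr yr] := near_q x y qr.
have Dxy : D (x, y) by apply: boxD; apply/ltW/half/ltW.
have [d d0 dP] := near0 x y qr.
split; last by rewrite y0 stem_V0// -y0.
apply/eqP; rewrite -normr_le0 leNgt; apply/negP => U0.
have /cts2P /(_ _ U0)[d' d'0 d'P] := stem_cU Dxy.
pose t := Num.min d d' / 2.
have t0 : 0 < t by rewrite divr_gt0// lt_min d0.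
have td : t < d /\ t < d'.
  by split; rewrite /t ltr_pdivrMr// gt_min; apply/orP; [left|right]; lra.
have yt : `|t - y| = t by rewrite y0 subr0 gtr0_norm.
have := d'P x t (z0 x _ d'0); rewrite yt => /(_ td.2).
have [|-> _] := UV1 x t _ (lt0r_neq0 t0).
  by apply: dP; [exact: z0|rewrite yt; exact: td.1].
by rewrite sub0r normrN ltxx.
Qed.

End Open.
End WithSystem.
End StemSystem.

(** * Radial potentials on R^4 and the strong maximum principle for stems *)

Section Radial.
Variable R : realType.
Local Notation V4 := 'rV[R]_4.
Implicit Types (v w z p : V4) (i j : 'I_4).

Definition rad v : R :=
  Num.sqrt (v ord0 i1 ^+ 2 + v ord0 i2 ^+ 2 + v ord0 i3 ^+ 2).

Lemma sum4 (F : 'I_4 -> R) : \sum_i F i = F i0 + F i1 + F i2 + F i3.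
Proof.
rewrite !big_ord_recl big_ord0 addr0 !addrA.
by congr (F _ + F _ + F _ + F _); exact/val_inj.
Qed.

Lemma ord4P i : [\/ i = i0, i = i1, i = i2 | i = i3].
Proof.
case: i => [[|[|[|[|//]]]] ltn];
  [constructor 1|constructor 2|constructor 3|constructor 4]; exact/val_inj.
Qed.

Lemma near0_ball (A : R -> Prop) (r : R) : 0 < r ->
  (forall t, `|t| < r -> A t) -> \forall t \near (0 : R), A t.
Proof.
move=> r0 rA; apply/nbhs_ballP; exists r => // t; rewrite -ball_normE /= => tr.
by apply: rA; rewrite -normrN -[- t]add0r.
Qed.

Lemma rad_ge0 v : 0 <= rad v. Proof. exact: sqrtr_ge0. Qed.

Lemma sqr_rad v : rad v ^+ 2 = v ord0 i1 ^+ 2 + v ord0 i2 ^+ 2 + v ord0 i3 ^+ 2.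
Proof. by rewrite sqr_sqrtr// !addr_ge0 ?sqr_ge0. Qed.

Lemma line_coord v i j (t : R) : (v + t *: bas R i) ord0 j = v ord0 j + t * (j == i)%:R.
Proof. by rewrite !mxE eqxx. Qed.

Lemma rad_line0 v (t : R) : rad (v + t *: bas R i0) = rad v.
Proof. by rewrite /rad !line_coord /= !mulr0 !addr0. Qed.

Lemma sqr_rad_line v i (t : R) : i != i0 ->
  rad (v + t *: bas R i) ^+ 2 = rad v ^+ 2 + (2 * v ord0 i * t + t ^+ 2).
Proof.
by case: (ord4P i) => -> // _; rewrite !sqr_rad !line_coord /=; ring.
Qed.

Lemma coord0_line v i (t : R) : i != i0 -> (v + t *: bas R i) ord0 i0 = v ord0 i0.
Proof. by move=> ni; rewrite line_coord eq_sym (negbTE ni) mulr0 addr0. Qed.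

Lemma rad_eq0 v i : rad v = 0 -> i != i0 -> v ord0 i = 0.
Proof.
move=> r0 ni; have := sqr_rad v; rewrite r0 expr0n /=.
have := sqr_ge0 (v ord0 i1); have := sqr_ge0 (v ord0 i2); have := sqr_ge0 (v ord0 i3).
move=> a1 a2 a3 /esym s0; apply/eqP; rewrite -sqrf_eq0 eq_le sqr_ge0 andbT.
by case: (ord4P i) ni => -> // _; lra.
Qed.

Lemma rad_axis_line v i (t : R) : rad v = 0 -> i != i0 ->
  rad (v + t *: bas R i) = `|t|.
Proof.
move=> r0 ni; rewrite -[LHS]ger0_norm ?rad_ge0// -sqrtr_sqr sqr_rad_line// r0 (rad_eq0 r0 ni).
by rewrite mulr0 mul0r expr0n !add0r sqrtr_sqr.
Qed.

Lemma rad_cts v : {for v, continuous rad}.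
Proof.
apply: (@cts_comp _ _ (@Num.sqrt R)
  (fun v : V4 => v ord0 i1 ^+ 2 + v ord0 i2 ^+ 2 + v ord0 i3 ^+ 2)).
  exact: sqrt_continuous.
by apply: ctsD; [apply: ctsD|]; apply: ctsX; exact: coord_cts.
Qed.

Lemma der_rad v i : rad v != 0 -> i != i0 ->
  der (fun t => rad (v + t *: bas R i)) 0 (v ord0 i / rad v).
Proof.
move=> r0 ni.
have rp : 0 < rad v ^+ 2 by rewrite exprn_gt0// lt_neqAle eq_sym r0 rad_ge0.
pose n (t : R) := rad v ^+ 2 + (2 * v ord0 i * t + t ^+ 2).
have -> : (fun t => rad (v + t *: bas R i)) = (fun t => Num.sqrt (n t)).
  apply/funext => t; rewrite /n -sqr_rad_line// sqrtr_sqr.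
  by rewrite ger0_norm ?rad_ge0.
have n0 : n 0 = rad v ^+ 2 by rewrite /n mulr0 expr0n !addr0.
have ds : der (@Num.sqrt R) (n 0) (2 * Num.sqrt (n 0))^-1.
  by apply: is_derive1_sqrt; rewrite n0.
have dn : der n 0 (2 * v ord0 i).
  apply: der_eq (derD (der_cst _ _) (derD (derMl _ (der_id _)) (der_sqr (der_id _)))) _.
  by rewrite !(mulr0, mul0r, mulr1, add0r, addr0).
apply: der_eq (der_comp ds dn) _; rewrite n0 sqrtr_sqr ger0_norm ?rad_ge0//.
by field.
Qed.

Lemma cts2_comp (U : R -> R -> R) (f g : V4 -> R) v : cts2 U (f v) (g v) ->
  {for v, continuous f} -> {for v, continuous g} ->
  {for v, continuous (fun w => U (f w) (g w))}.
Proof.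
move=> /cts2P cU /ctsP cf /ctsP cg; apply/ctsP => e /cU[r r0 rP].
near=> w; rewrite distrC; apply: rP; rewrite distrC; near: w.
  exact: cf.
exact: cg.
Unshelve. all: by end_near. Qed.

Section Potential.
Variables (D : set (R * R)) (U V Ux Vx Vy c : R -> R -> R) (a b rho : R).
Hypothesis sys : stem_system D U V Ux Vx Vy.
Hypothesis oD : open D.
Hypothesis rho0 : 0 < rho.
Hypothesis boxD : forall x y, `|x - a| <= rho -> `|y - b| <= rho -> D (x, y).
Hypothesis cP : forall x y, `|x - a| < rho -> `|y - b| < rho ->
  der (c ^~ y) x (- U x y) /\ der (c x) y (V x y).
Hypothesis axis : b = 0 \/ rho < b.

(** By [axis] a tube either is centred on the real axis, where [c] is even, or avoids that axis
    altogether. *)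
Definition tube : set V4 :=
  [set v : V4 | `|v ord0 i0 - a| < rho /\ `|rad v - b| < rho].

Lemma tube_D v : tube v -> D (v ord0 i0, rad v).
Proof. by case=> /ltW xr /ltW yr; exact: boxD. Qed.

Lemma tube_axis v : tube v -> rad v = 0 -> b = 0.
Proof.
move=> [_ +] r0; rewrite r0 sub0r normrN; case: axis => // rb.
have b0 : 0 < b := lt_trans rho0 rb.
by rewrite gtr0_norm// => br; lra.
Qed.

Definition radial v : R := c (v ord0 i0) (rad v).

Lemma der_radial0 v : tube v ->
  der (fun t => radial (v + t *: bas R i0)) 0 (- U (v ord0 i0) (rad v)).
Proof.
move=> [xr yr]; rewrite (_ : (fun t => _) = (fun t => c (v ord0 i0 + t) (rad v))).
  apply: (@der_shift _ (c ^~ (rad v))); rewrite addr0.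
  by have [] := cP xr yr.
by apply/funext => t; rewrite /radial rad_line0 line_coord eqxx mulr1.
Qed.

(** The formula also holds on the real axis: there [v ord0 i = 0] and division by zero gives 0, so
    the right side is 0, which is the derivative [V x 0] of the even function [c x]. *)
Lemma der_radial v i : i != i0 -> tube v ->
  der (fun t => radial (v + t *: bas R i)) 0
    (v ord0 i / rad v * V (v ord0 i0) (rad v)).
Proof.
move=> ni tv; have [xr yr] := tv; have [_ cy] := cP xr yr.
have -> : (fun t => radial (v + t *: bas R i)) =
    (fun t => c (v ord0 i0) (rad (v + t *: bas R i))).
  by apply/funext => t; rewrite /radial coord0_line.
have [r0|r0] := eqVneq (rad v) 0; last first.
  have cy' : der (c (v ord0 i0)) (rad (v + 0 *: bas R i)) (V (v ord0 i0) (rad v)).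
    by rewrite scale0r addr0.
  by apply: der_eq (@der_comp _ _ (fun t => rad (v + t *: bas R i)) 0 _ _ cy'
    (der_rad r0 ni)) _; rewrite mulrC.
have b0 := tube_axis tv r0.
have D0 : D (v ord0 i0, 0) by have := tube_D tv; rewrite r0.
have -> : v ord0 i / rad v * V (v ord0 i0) (rad v) = V (v ord0 i0) 0.
  by rewrite (rad_eq0 r0 ni) !mul0r (stem_V0 sys).
have -> : (fun t : R => c (v ord0 i0) (rad (v + t *: bas R i))) =
    (fun t => c (v ord0 i0) `|t|).
  by apply/funext => t; rewrite rad_axis_line.
rewrite r0 in cy; apply: (@der_near _ (c (v ord0 i0))) => //.
apply: (near0_ball rho0) => t tr.
have [t0|t0] := leP 0 t; first by rewrite ger0_norm.
by rewrite ltr0_norm// (potential_even sys boxD cP).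
Qed.

(** Off the axis the imaginary second derivatives add up to [V_y + 2 V / r], since the squares
    [v_i^2] sum to [r^2]. On the axis each of the three equals [V_y], so harmonicity there is the
    degenerate equation [stem_eq0]. *)
Lemma radial_harmonic : has_laplacian tube radial (fun=> 0).
Proof.
exists (fun i (v : V4) => if i == i0 then - U (v ord0 i0) (rad v)
  else v ord0 i / rad v * V (v ord0 i0) (rad v)).
exists (fun i (v : V4) => if i == i0 then - Ux (v ord0 i0) (rad v)
  else if rad v == 0 then Vy (v ord0 i0) 0
  else ((rad v)^-1 - v ord0 i ^+ 2 / rad v ^+ 3) * V (v ord0 i0) (rad v) +
       v ord0 i ^+ 2 / rad v ^+ 2 * Vy (v ord0 i0) (rad v)).
move=> v tv; have [xr yr] := tv; have Dv := tube_D tv.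
split => [i|i|].
- by case: eqVneq => [->|ni]; [exact: der_radial0|exact: der_radial].
- case: eqVneq => [->|ni].
    rewrite (_ : (fun t => _) = (fun t => - U (v ord0 i0 + t) (rad v))).
      apply: (@der_shift _ (fun t => - U t (rad v))); rewrite addr0.
      by apply: derN; exact: (stem_Ux sys).
    by apply/funext => t; rewrite rad_line0 line_coord eqxx mulr1.
  have [r0|r0] := eqVneq (rad v) 0.
    have D0 : D (v ord0 i0, 0) by move: Dv; rewrite r0.
    have b0 := tube_axis tv r0.
    apply: (@der_near _ (V (v ord0 i0))); last exact: (stem_Vy sys).
    apply: (near0_ball rho0) => t tr.
    rewrite coord0_line// rad_axis_line// line_coord eqxx mulr1 (rad_eq0 r0 ni) add0r.
    have [t0|t0|<-] := ltgtP 0 t; last by rewrite mul0r mul0r (stem_V0 sys).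
      by rewrite gtr0_norm// divff ?mul1r// gt_eqF.
    rewrite ltr0_norm// invrN mulrN divff ?lt_eqF// mulN1r (stem_odd sys) ?opprK//.
    by apply: boxD; [exact: ltW|rewrite b0 subr0 ltW].
  pose vi : R := v ord0 i.
  have -> : (fun t => (v + t *: bas R i) ord0 i / rad (v + t *: bas R i) *
      V ((v + t *: bas R i) ord0 i0) (rad (v + t *: bas R i))) =
      (fun t => (vi + t) * (rad (v + t *: bas R i))^-1 *
        V (v ord0 i0) (rad (v + t *: bas R i))).
    by apply/funext => t; rewrite coord0_line// line_coord eqxx mulr1.
  have v0 : v + 0 *: bas R i = v by rewrite scale0r addr0.
  have dr := der_rad r0 ni.
  have dV : der (V (v ord0 i0)) (rad (v + 0 *: bas R i)) (Vy (v ord0 i0) (rad v)).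
    by rewrite v0; exact: (stem_Vy sys).
  have rn : rad (v + 0 *: bas R i) != 0 by rewrite v0.
  apply: der_eq (derM (derM (derD (der_cst vi 0) (der_id 0))
    (@derV _ (fun t => rad (v + t *: bas R i)) 0 _ rn dr))
    (@der_comp _ _ (fun t => rad (v + t *: bas R i)) 0 _ _ dV dr)) _.
  by rewrite v0 -/vi; field.
- rewrite sum4 /=.
  have [r0|r0] := eqVneq (rad v) 0.
    have D0 : D (v ord0 i0, 0) by move: Dv; rewrite r0.
    by rewrite r0 (stem_eq0 sys D0); ring.
  have E := sqr_rad v; have F := stem_eq sys Dv.
  have {}F : Ux (v ord0 i0) (rad v) =
      Vy (v ord0 i0) (rad v) + 2 * V (v ord0 i0) (rad v) / rad v.
    by apply: (mulfI r0); rewrite F; field.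
  rewrite F (_ : v ord0 i3 ^+ 2 = rad v ^+ 2 - v ord0 i1 ^+ 2 - v ord0 i2 ^+ 2).
    by field.
  by rewrite E; ring.
Qed.

Lemma radial_cts v : tube v -> {for v, continuous radial}.
Proof.
move=> [xr yr]; apply: (@cts2_comp c (fun v : V4 => v ord0 i0) rad).
- exact: (potential_cts sys oD boxD cP).
- exact: coord_cts.
- exact: rad_cts.
Qed.

End Potential.

Lemma has_laplacian_shift (A : set V4) S L w : has_laplacian A S L ->
  has_laplacian [set v | A (v + w)] (fun v => S (v + w)) (fun v => L (v + w)).
Proof.
move=> [S1 [S2 H]]; exists (fun i v => S1 i (v + w)), (fun i v => S2 i (v + w)).
move=> v /= /H[d1 d2 SL]; split => // i.
  rewrite (_ : (fun t => _) = (fun t => S (v + w + t *: bas R i)))//.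
  by apply/funext => t; rewrite addrAC.
rewrite (_ : (fun t => _) = (fun t => S1 i (v + w + t *: bas R i)))//.
by apply/funext => t; rewrite addrAC.
Qed.

Lemma has_laplacian_eq (A : set V4) S L L' : (forall v, A v -> L v = L' v) ->
  has_laplacian A S L -> has_laplacian A S L'.
Proof.
move=> LL' [S1 [S2 H]]; exists S1, S2 => v Av.
by have [d1 d2 SL] := H v Av; rewrite -LL'.
Qed.

Lemma shift_cts (S : V4 -> R) v w : {for v + w, continuous S} ->
  {for v, continuous (fun u : V4 => S (u + w))}.
Proof.
move=> /ctsP cS; apply/ctsP => e /cS /nbhs_ballP[r /= r0 rP].
apply/nbhs_ballP; exists r => //= u; rewrite -ball_normE /= => uv.
apply: rP; rewrite -ball_normE /= (_ : v + w - (u + w) = v - u)//.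
by rewrite opprD addrACA subrr addr0.
Qed.

(** A difference quotient of [C] combines translates of a harmonic function, hence is harmonic, and
    by the mean value theorem it equals [G] at a point shifted by at most the step. No second
    derivative of [G] is involved. *)
Lemma quotient_harmonic_limit (A B : set V4) (C G : V4 -> R) i :
  open A -> B `<=` A -> has_laplacian A C (fun=> 0) ->
  (forall v, A v -> {for v, continuous C}) ->
  (forall v, A v -> der (fun t => C (v + t *: bas R i)) 0 (G v)) ->
  (forall v, A v -> {for v, continuous G}) ->
  harmonic_limit B G.
Proof.
move=> oA BA hC cC dC cG z r eta r0 eta0 zB.
have [e e0 eP] : exists2 e : R, 0 < e & forall t, `|t| < e ->
    forall v, `|v - z| <= r -> A (v + t *: bas R i) /\
      `|G (v + t *: bas R i) - G v| <= eta.
  (* Compactness in its covering form makes the estimate on [G (v + t *: bas R i) - G v] uniform in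
     [v] for small [t]. *)
  have /compact_near_coveringP cov := @cball_compact R z r.
  have /nbhs_ballP[e /= e0 eP] : \forall t \near (0 : R),
      [set v | `|v - z| <= r] `<=` [set v | A (v + t *: bas R i) /\
      `|G (v + t *: bas R i) - G v| <= eta].
    apply: (cov R (nbhs (0 : R)) (fun t v => A (v + t *: bas R i) /\
      `|G (v + t *: bas R i) - G v| <= eta)) => v /= vr; have Av := BA _ (zB v vr).
    have /nbhs_ballP[d1 /= d10 d1P] : nbhs v A by exact: open_nbhs_nbhs.
    have e2 : 0 < eta / 2 by rewrite divr_gt0.
    have /ctsP /(_ _ e2) /nbhs_ballP[d2 /= d20 d2P] := cG v Av.
    pose d := Num.min d1 d2.
    have d0 : 0 < d by rewrite lt_min d10 d20.
    have dP u : `|v - u| < d -> A u /\ `|G v - G u| < eta / 2.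
      rewrite lt_min => /andP[u1 u2].
      by split; [apply: d1P|apply: d2P]; rewrite -ball_normE.
    exists ([set u | `|v - u| < d / 2], [set t : R | `|t| < d / 2]) => /=.
      split; last by apply: (near0_ball (r := d / 2)) => //; rewrite divr_gt0.
      apply/nbhs_ballP; exists (d / 2); first by rewrite /= divr_gt0.
      by move=> u; rewrite -ball_normE.
    move=> [u t] /= [ud td].
    have ut : `|v - (u + t *: bas R i)| < d.
      rewrite opprD addrA; apply: le_lt_trans (ler_normB _ _) _.
      have := norm_shift_bas 0 i t; rewrite add0r normr0 add0r; lra.
    have [Aut Gut] := dP _ ut; split => //.
    have [_ Gu] := dP u ltac:(lra).
    have := ler_normD (G (u + t *: bas R i) - G v) (G v - G u); rewrite subrKA.
    by rewrite distrC in Gut; lra.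
  exists e => // t te v vr; apply: (eP t) => //.
  by rewrite -ball_normE /= sub0r normrN.
pose h := e / 2.
have h0 : 0 < h by rewrite divr_gt0.
have he : `|h| < e by rewrite gtr0_norm// /h; lra.
exists (fun v => h^-1 * (C (v + h *: bas R i) + (-1) * C v)); split.
- apply: (@has_laplacian_eq _ _ (fun v => h^-1 * (0 + (-1) * 0))).
    by move=> v _; rewrite mulr0 addr0 mulr0.
  apply: has_laplacianZ; apply: has_laplacianD.
    apply: has_laplacian_sub (has_laplacian_shift (h *: bas R i) hC) => v /= /ltW vr.
    by have [] := eP h he v vr.
  apply: has_laplacianZ; apply: has_laplacian_sub hC => v /= /ltW vr.
  exact/BA/zB.
- move=> v vr; have [Av _] := eP h he v vr.
  apply: ctsM; first exact: cts_cst.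
  apply: ctsD; first by apply: shift_cts; exact: cC.
  by apply: ctsM; [exact: cts_cst|apply: cC; exact/BA/zB].
- move=> v vr.
  have [t /andP[t0 th]] : exists2 t, 0 < t < h &
      C (v + h *: bas R i) - C (v + 0 *: bas R i) = G (v + t *: bas R i) * (h - 0).
    apply: (@mean_value _ (fun t => C (v + t *: bas R i))) => // t /andP[t0 th].
    apply: der_line; apply: dC.
    have te : `|t| < e by rewrite ger0_norm//; move: th; rewrite /h => th; lra.
    by have [] := eP t te v vr.
  rewrite scale0r addr0 subr0 mulN1r => ->; rewrite mulrCA mulVf ?gt_eqF// mulr1.
  have te : `|t| < e by rewrite gtr0_norm//; move: th; rewrite /h => th; lra.
  by have [] := eP t te v vr.
Qed.

Lemma harmonic_limitD (B : set V4) (s s' : V4 -> R) :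
  harmonic_limit B s -> harmonic_limit B s' ->
  harmonic_limit B (fun v => s v + s' v).
Proof.
move=> hs hs' z r eta r0 eta0 zB; have e2 : 0 < eta / 2 by rewrite divr_gt0.
have [T [lT cT aT]] := hs z r _ r0 e2 zB; have [T' [lT' cT' aT']] := hs' z r _ r0 e2 zB.
exists (fun v => T v + T' v); split.
- apply: (@has_laplacian_eq _ _ (fun=> 0 + 0)); first by move=> v _; rewrite addr0.
  exact: has_laplacianD.
- by move=> v vr; apply: ctsD; [exact: cT|exact: cT'].
- move=> v vr; rewrite opprD addrACA; apply: le_trans (ler_normD _ _) _.
  by have := aT v vr; have := aT' v vr; lra.
Qed.

Lemma harmonic_limitN (B : set V4) (s : V4 -> R) :
  harmonic_limit B (fun v => - s v) -> harmonic_limit B s.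
Proof.
move=> hs z r eta r0 eta0 zB; have [T [lT cT aT]] := hs z r _ r0 eta0 zB.
exists (fun v => (-1) * T v); split.
- apply: (@has_laplacian_eq _ _ (fun=> -1 * 0)); first by move=> v _; rewrite mulr0.
  exact: has_laplacianZ.
- by move=> v vr; apply: ctsM; [exact: cts_cst|exact: cT].
- by move=> v vr; have := aT v vr; rewrite mulN1r -opprD normrN opprK.
Qed.

Definition pt4 (x y : R) : V4 := x *: bas R i0 + y *: bas R i1.

Lemma pt4E (x y : R) : pt4 x y ord0 i0 = x /\ rad (pt4 x y) = `|y|.
Proof.
rewrite /rad /pt4 !mxE !eqxx /= !(mulr0, mulr1, add0r, addr0).
by rewrite expr0n !addr0 sqrtr_sqr.
Qed.

(* The function below is the scalar product of f(x + y_1 I) (averaged over +-J) with a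
   fixed octonion; (U, V) and (U', V') come from two different functionals. *)
Lemma stem_strong_maximum D (U V Ux Vx Vy U' V' Ux' Vx' Vy' : R -> R -> R) (a b e : R) :
  open D -> stem_system D U V Ux Vx Vy -> stem_system D U' V' Ux' Vx' Vy' ->
  D (a, b) -> 0 < b \/ b = 0 /\ (forall x y, V' x y = 0) ->
  let s v := U (v ord0 i0) (rad v) + v ord0 i1 / rad v * V' (v ord0 i0) (rad v) in
  0 < e -> (forall v, `|v - pt4 a b| < e -> s v <= s (pt4 a b)) ->
  exists2 d : R, 0 < d & forall v, `|v - pt4 a b| < d -> s v = s (pt4 a b).
Proof.
move=> oD sys sys' Dab bP s e0 smax.
have [rho1 rho10 box1] := open_box oD Dab.
have [rho rho0 [box axis]] : exists2 rho : R, 0 < rho &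
    (forall x y, `|x - a| <= rho -> `|y - b| <= rho -> D (x, y)) /\ (b = 0 \/ rho < b).
  case: bP => [b0|[b0 _]]; last by exists rho1 => //; split; [|left].
  (* For [b > 0] the box stays away from the axis, where the factor [v_1 / rad v] is
     discontinuous. *)
  exists (Num.min rho1 (b / 2)); first by rewrite lt_min rho10 divr_gt0.
  split; last by right; rewrite gt_min; apply/orP; right; lra.
  by move=> x y; rewrite !le_min => /andP[x1 _] /andP[y1 _]; exact: box1.
have [c cP] := stem_potential sys oD box; have [c' cP'] := stem_potential sys' oD box.
have cx v := @coord_cts R i0 v.
have tube_open : open (tube a b rho).
  rewrite openE => v [xr yr]; rewrite /interior.
  have f1 : {for v, continuous (fun v : V4 => `|v ord0 i0 - a|)}.
    apply: (@cts_comp _ _ (@Num.norm _ R) (fun v : V4 => v ord0 i0 - a)).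
      exact: norm_continuous.
    by apply: ctsB; [exact: cx|exact: cts_cst].
  have f2 : {for v, continuous (fun v : V4 => `|rad v - b|)}.
    apply: (@cts_comp _ _ (@Num.norm _ R) (fun v : V4 => rad v - b)).
      exact: norm_continuous.
    by apply: ctsB; [exact: rad_cts|exact: cts_cst].
  have g1 : 0 < rho - `|v ord0 i0 - a| by rewrite subr_gt0.
  have g2 : 0 < rho - `|rad v - b| by rewrite subr_gt0.
  move/ctsP: f1 => /(_ _ g1) f1; move/ctsP: f2 => /(_ _ g2) f2.
  near=> w; split.
    have : `| `|v ord0 i0 - a| - `|w ord0 i0 - a| | < rho - `|v ord0 i0 - a|.
      by near: w.
    by rewrite ltr_norml; lra.
  have : `| `|rad v - b| - `|rad w - b| | < rho - `|rad v - b| by near: w.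
  by rewrite ltr_norml; lra.
have b_ge0 : 0 <= b by case: bP => [/ltW|[->]].
have tp : tube a b rho (pt4 a b).
  have [p0 pr] := pt4E a b.
  by split; rewrite ?p0 ?pr ?(ger0_norm b_ge0) subrr normr0.
have /nbhs_ballP[r /= r0 rT] : nbhs (pt4 a b) (tube a b rho) by exact: open_nbhs_nbhs.
pose d := Num.min r e.
have d0 : 0 < d by rewrite lt_min r0 e0.
have dr v : `|v - pt4 a b| < d -> tube a b rho v.
  by rewrite lt_min => /andP[vr _]; apply: rT; rewrite -ball_normE /= distrC.
have cU v : tube a b rho v -> {for v, continuous (fun v => U (v ord0 i0) (rad v))}.
  move=> tv; apply: (@cts2_comp U (fun v : V4 => v ord0 i0) rad) => //.
    exact: (stem_cU sys oD (tube_D box tv)).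
  exact: rad_cts.
have cV v : tube a b rho v ->
    {for v, continuous (fun v => v ord0 i1 / rad v * V' (v ord0 i0) (rad v))}.
  move=> tv; case: bP => [b0|[_ V0]]; last first.
    rewrite (_ : (fun v => _) = fun=> 0); first exact: cts_cst.
    by apply/funext => w; rewrite V0 mulr0.
  have rv : rad v != 0.
    apply/eqP => rv; move: (tube_axis rho0 axis tv rv) b0 => ->.
    by rewrite ltxx.
  apply: ctsM.
    by apply: ctsM; [exact: coord_cts|apply: ctsV => //; exact: rad_cts].
  apply: (@cts2_comp V' (fun v : V4 => v ord0 i0) rad) => //.
    exact: (stem_cV sys' oD (tube_D box tv)).
  exact: rad_cts.
exists (d / 16); first by rewrite divr_gt0.
apply: (strong_maximum d0) => [v vd||v]; last first.
- by rewrite lt_min => /andP[_]; exact: smax.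
(* The first summand is minus the derivative of [radial c] along axis 0, the second is the
   derivative of [radial c'] along axis 1. *)
- apply: harmonic_limitD.
    apply: harmonic_limitN.
    apply: (@quotient_harmonic_limit _ _ (radial c) _ i0 tube_open dr).
    + exact: (radial_harmonic sys rho0 box cP axis).
    + by move=> v; exact: (radial_cts sys oD box cP).
    + by move=> v; exact: (der_radial0 cP).
    + by move=> v /cU; exact: ctsN.
  apply: (@quotient_harmonic_limit _ _ (radial c') _ i1 tube_open dr).
  + exact: (radial_harmonic sys' rho0 box cP' axis).
  + by move=> v; exact: (radial_cts sys' oD box cP').
  + by move=> v; exact: (der_radial sys' rho0 box cP' axis).
  + exact: cV.
- by apply: ctsD; [exact/cU/dr|exact/cV/dr].
Unshelve. all: by end_near. Qed.

End Radial.

(** * Octonion algebra in coordinates *)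

Section OctonionAlgebra.
Variable R : realType.
Local Notation O := (oct R).
Implicit Types (x y z w v e I J K : O) (a b : quat R) (r t : R).

Lemma oct_ext x y :
  [/\ oc x 0 = oc y 0, oc x 1 = oc y 1, oc x 2 = oc y 2 & oc x 3 = oc y 3] ->
  [/\ oc x 4 = oc y 4, oc x 5 = oc y 5, oc x 6 = oc y 6 & oc x 7 = oc y 7] -> x = y.
Proof.
move=> [h0 h1 h2 h3] [h4 h5 h6 h7]; apply/rowP => j; rewrite -(inord_val j).
by case: j => [[|[|[|[|[|[|[|[|//]]]]]]]] jlt] /=.
Qed.

Lemma ocD x y k : oc (x + y) k = oc x k + oc y k. Proof. by rewrite /oc mxE. Qed.
Lemma ocN x k : oc (- x) k = - oc x k. Proof. by rewrite /oc mxE. Qed.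
Lemma ocZ r x k : oc (r *: x) k = r * oc x k. Proof. by rewrite /oc mxE. Qed.
Lemma oc0 k : oc (0 : O) k = 0. Proof. by rewrite /oc mxE. Qed.

Lemma oc_mk a b k : (k < 8)%N -> oc (mk_oct a b) k =
  nth 0 [:: q0 a; q1 a; q2 a; q3 a; q0 b; q1 b; q2 b; q3 b] k.
Proof. by move=> k8; rewrite /oc mxE inordK. Qed.

Definition ocE := (ocD, ocN, ocZ, oc0).

Ltac oct_ring := apply: oct_ext; split;
  rewrite ?ocE /omul /oreal ?oc_mk //= ?ocE /omul ?oc_mk //= ?ocE; ring.

Lemma omulDl x y z : omul (x + y) z = omul x z + omul y z.
Proof. oct_ring. Qed.

Lemma omulZl r x y : omul (r *: x) y = r *: omul x y.
Proof. oct_ring. Qed.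

Lemma omulNl x y : omul (- x) y = - omul x y.
Proof. by rewrite -scaleN1r omulZl scaleN1r. Qed.

Lemma omul0r x : omul x 0 = 0.
Proof. oct_ring. Qed.

Lemma oinnerE x y : oinner x y = oc x 0 * oc y 0 + oc x 1 * oc y 1 + oc x 2 * oc y 2
  + oc x 3 * oc y 3 + oc x 4 * oc y 4 + oc x 5 * oc y 5 + oc x 6 * oc y 6 + oc x 7 * oc y 7.
Proof.
rewrite /oinner /oc !big_ord_recl big_ord0 addr0 !addrA /=.
by do ![congr (_ + _)]; congr (x ord0 _ * y ord0 _); apply/val_inj; rewrite /= inordK.
Qed.

Lemma oinnerDl x y z : oinner (x + y) z = oinner x z + oinner y z.
Proof. by rewrite !oinnerE !ocE; ring. Qed.

Lemma oinnerZl r x z : oinner (r *: x) z = r * oinner x z.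
Proof. by rewrite !oinnerE !ocE; ring. Qed.

Lemma oinnerNl x z : oinner (- x) z = - oinner x z.
Proof. by rewrite -scaleN1r oinnerZl mulN1r. Qed.

Lemma oinnerBl x y z : oinner (x - y) z = oinner x z - oinner y z.
Proof. by rewrite oinnerDl oinnerNl. Qed.

Lemma oinner0l z : oinner 0 z = 0.
Proof. by rewrite -(scale0r (0 : O)) oinnerZl mul0r. Qed.

Lemma oinnerC x y : oinner x y = oinner y x.
Proof. by rewrite !oinnerE; ring. Qed.

Lemma oinner_ge0 x : 0 <= oinner x x.
Proof. by apply: sumr_ge0 => j _; rewrite -expr2 sqr_ge0. Qed.

Lemma oinner_eq0 x : oinner x x = 0 -> x = 0.
Proof.
move=> /eqP; rewrite psumr_eq0 => [/allP H|j _]; last by rewrite -expr2 sqr_ge0.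
apply/rowP => j; have := H j; rewrite mem_index_enum => /(_ isT).
by rewrite -expr2 sqrf_eq0 mxE => /eqP.
Qed.

Lemma onorm_le x y : onorm x <= onorm y -> oinner x x <= oinner y y.
Proof. by rewrite ler_sqrt ?oinner_ge0. Qed.

(** The imaginary coordinates of [I I] are [2 I_0 I_k]. If [I_0] were nonzero, all [I_k] would
    vanish and [I_0^2 = -1] would remain. *)
Lemma sphereSP I : sphereS I <-> oc I 0 = 0 /\ oinner I I = 1.
Proof.
rewrite oinnerE; split => [II|[h0 h1]].
  have E k : oc (omul I I) k = oc (- oreal 1) k by rewrite II.
  move: (E 0%N) (E 1%N) (E 2%N) (E 3%N) (E 4%N) (E 5%N) (E 6%N) (E 7%N).
  rewrite ocN !ocN /omul /oreal !oc_mk //= => e0 e1 e2 e3 e4 e5 e6 e7.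
  have h0 : oc I 0 = 0.
    apply/eqP; apply/negPn/negP => n0.
    have z k : oc I 0 * oc I k = 0 -> oc I k = 0.
      by move=> /eqP; rewrite mulf_eq0 (negbTE n0) => /eqP.
    have {}e1 : oc I 1 = 0 by apply: z; lra.
    have {}e2 : oc I 2 = 0 by apply: z; lra.
    have {}e3 : oc I 3 = 0 by apply: z; lra.
    have {}e4 : oc I 4 = 0 by apply: z; lra.
    have {}e5 : oc I 5 = 0 by apply: z; lra.
    have {}e6 : oc I 6 = 0 by apply: z; lra.
    have {}e7 : oc I 7 = 0 by apply: z; lra.
    move: e0; rewrite e1 e2 e3 e4 e5 e6 e7 => e0.
    by have := sqr_ge0 (oc I 0); rewrite expr2; lra.
  by split => //; move: e0; rewrite h0; lra.
rewrite /sphereS /=; apply: oct_ext; split;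
  rewrite ocN /omul /oreal !oc_mk //= h0; rewrite h0 in h1; lra.
Qed.

Lemma sphereSN I : sphereS I -> sphereS (- I).
Proof.
rewrite !sphereSP !oinnerE !ocE => -[-> H]; split; first by rewrite oppr0.
by rewrite -H; ring.
Qed.

Lemma sphereS_comb I J r t : sphereS I -> sphereS J -> oinner I J = 0 ->
  r ^+ 2 + t ^+ 2 = 1 -> sphereS (r *: I + t *: J).
Proof.
rewrite !sphereSP => -[i0 iI] [j0 jJ] IJ rt; split.
  by rewrite !ocE i0 j0 !mulr0 addr0.
have -> : oinner (r *: I + t *: J) (r *: I + t *: J) =
    r ^+ 2 * oinner I I + t ^+ 2 * oinner J J + 2 * r * t * oinner I J.
  by rewrite !oinnerE !ocE; ring.
by rewrite iI jJ IJ !mulr1 mulr0 addr0.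
Qed.

(** Left alternativity, the weak form of associativity that the octonions retain; it makes left
    multiplication by [I] injective. *)
Lemma sphereS_mul I v : sphereS I -> omul I (omul I v) = - v.
Proof.
rewrite sphereSP => -[h0 h1].
have -> : omul I (omul I v) = (- oinner I I) *: v; last by rewrite h1 scaleN1r.
apply: oct_ext; split; rewrite ocZ oinnerE /omul !oc_mk //= !oc_mk //= h0; ring.
Qed.

Lemma sphereS_mul_eq0 I v : sphereS I -> omul I v = 0 -> v = 0.
Proof.
move=> SI Iv; have := sphereS_mul v SI; rewrite Iv omul0r => /esym/eqP.
by rewrite oppr_eq0 => /eqP.
Qed.

(** The adjoint of left multiplication by [I] is multiplication by its conjugate, which is [- I].
    This turns the scalar product with [I v] into a functional of [v] alone. *)
Lemma oinner_mul I v e : sphereS I -> oinner (omul I v) e = oinner v (- omul I e).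
Proof.
by rewrite sphereSP => -[h0 _]; rewrite !oinnerE !ocE /omul !oc_mk //= h0; ring.
Qed.

(** The witness turns the first two imaginary coordinates by a right angle and normalises; if both
    vanish, the first imaginary unit is already orthogonal to [I]. *)
Lemma sphereS_ortho I : sphereS I -> exists2 J, sphereS J & oinner I J = 0.
Proof.
rewrite sphereSP => -[h0 h1].
have [z|nz] := eqVneq (oc I 1 ^+ 2 + oc I 2 ^+ 2) 0.
  have h : oc I 1 = 0.
    apply/eqP; rewrite -sqrf_eq0 eq_le sqr_ge0 andbT.
    by have := sqr_ge0 (oc I 2); lra.
  exists (mk_oct (Quat 0 1 0 0) (Quat 0 0 0 0)).
    by rewrite sphereSP oinnerE !oc_mk //=; split=> //; ring.
  by rewrite oinnerE !oc_mk //= h; ring.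
pose n := Num.sqrt (oc I 1 ^+ 2 + oc I 2 ^+ 2).
have n2 : n ^+ 2 = oc I 1 ^+ 2 + oc I 2 ^+ 2 by rewrite sqr_sqrtr// addr_ge0 ?sqr_ge0.
have n0 : n != 0 by apply: contra_neq nz => n0; rewrite -n2 n0 expr0n.
exists (mk_oct (Quat 0 (- oc I 2 / n) (oc I 1 / n) 0) (Quat 0 0 0 0)).
  rewrite sphereSP oinnerE !oc_mk //=; split=> //.
  rewrite (_ : _ + _ = (oc I 1 ^+ 2 + oc I 2 ^+ 2) / n ^+ 2); last by field.
  by rewrite -n2 divff// expf_neq0.
by rewrite oinnerE !oc_mk //=; ring.
Qed.

Lemma oc_real r k : (k < 8)%N -> oc (oreal r) k = if k == 0%N then r else 0.
Proof.
by move=> k8; rewrite /oreal oc_mk//; case: k k8 => [|[|[|[|[|[|[|[|//]]]]]]]].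
Qed.

Lemma eq_of_inner e z : oinner z z <= oinner e e -> oinner z e = oinner e e -> z = e.
Proof.
move=> ze zee; apply/eqP; rewrite -subr_eq0; apply/eqP/oinner_eq0/eqP.
have E : oinner (z - e) (z - e) = oinner z z - 2 * oinner z e + oinner e e.
  by rewrite !oinnerE !ocE; ring.
by rewrite eq_le oinner_ge0 andbT E zee; lra.
Qed.

End OctonionAlgebra.

(** * From the Fueter system to the stem system *)

Section StemOfRegular.
Variable R : realType.
Local Notation O := (oct R).
Local Notation C4 := 'cV[R]_4.
Implicit Types (n v : C4) (w : O).

Definition cpt (x y : R) : C4 := x *: ebas R i0 + y *: ebas R i1.

Lemma cptE (x y : R) : [/\ vc (cpt x y) i0 = x, vc (cpt x y) i1 = y,
  vc (cpt x y) i2 = 0 & vc (cpt x y) i3 = 0].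
Proof. by rewrite /vc /cpt !mxE /=; split; ring. Qed.

Lemma vcD v n i : vc (v + n) i = vc v i + vc n i. Proof. by rewrite /vc mxE. Qed.
Lemma vcZ (r : R) v i : vc (r *: v) i = r * vc v i. Proof. by rewrite /vc mxE. Qed.
Lemma vc_ebas i j : vc (ebas R i) j = (j == i)%:R.
Proof. by rewrite /vc mxE eqxx andbT. Qed.

Lemma der_line_inner (g : C4 -> O) v i w : derivable g v (ebas R i) ->
  der (fun t => oinner (g (v + t *: ebas R i)) w) 0 (oinner (pd g i v) w).
Proof.
move=> dg.
have dj j : der (fun t : R => g (v + t *: ebas R i) ord0 j) 0 (pd g i v ord0 j).
  pose G (u : C4) : R := g u ord0 j.
  have E : (fun h : R => h^-1 *: ((G \o shift v) (h *: ebas R i) - G v)) =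
      (fun h : R => h^-1 *: (((fun t : R => g (v + t *: ebas R i) ord0 j) \o shift 0)
        (h *: (1 : R)) - (fun t : R => g (v + t *: ebas R i) ord0 j) 0)).
    apply/funext => h; rewrite /G /= addr0 scale0r addr0.
    by rewrite [X in v + X *: _]mulr1 [_ + v]addrC.
  apply: DeriveDef; last first.
    rewrite /pd derive_mx// mxE /derive /=.
    by rewrite -E.
  by rewrite /derivable -E; move/derivable_mxP : dg => /(_ ord0 j).
rewrite /oinner.
have : forall k (F : 'I_k -> R -> R) (d : 'I_k -> R), (forall j, der (F j) 0 (d j)) ->
    der (fun t => \sum_(j < k) F j t) 0 (\sum_(j < k) d j).
  elim=> [|k IH] F d H.
    rewrite big_ord0 (_ : (fun t => _) = fun=> 0); first exact: der_cst.
    by apply/funext => t; rewrite big_ord0.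
  rewrite big_ord_recl (_ : (fun t => _) =
    fun t => F ord0 t + \sum_(j < k) F (lift ord0 j) t).
    by apply: derD => //; exact: IH.
  by apply/funext => t; rewrite big_ord_recl.
apply => j.
by apply: der_eq (derM (dj j) (der_cst (w ord0 j) 0)) _; rewrite mulr0 add0r mulrC.
Qed.

Lemma cts2_inner (g : C4 -> O) w (x y : R) : {for cpt x y, continuous g} ->
  cts2 (fun x y => oinner (g (cpt x y)) w) x y.
Proof.
move=> cg.
have cp : {for (x, y), continuous (fun z : R * R => cpt z.1 z.2)}.
  apply/cvg_ballP => e e0; apply/near2P; exists e => // x' y' xe ye /=.
  have bx : ball x e x' by rewrite -ball_normE /= distrC.
  have b_y : ball y e y' by rewrite -ball_normE /= distrC.
  split => // i j; rewrite (ord1 j) /cpt !mxE.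
  case: (ord4P i) => -> /=; rewrite !(mulr0, mulr1, addr0, add0r)//; exact: ballxx.
apply: cts_sum => j; apply: ctsM; last exact: cts_cst.
have ch : {for (x, y), continuous (fun z : R * R => g (cpt z.1 z.2))}.
  by apply: (@continuous_comp _ _ _ (fun z : R * R => cpt z.1 z.2) g).
by apply: (@continuous_comp _ _ _ (fun z : R * R => g (cpt z.1 z.2))
  (fun M : O => M ord0 j)) => //; exact: coord_continuous.
Qed.

Section Regular.
Variables (D : set (R * R)) (f : O -> O) (F : 'I_4 -> C4 -> O).
Hypothesis oD : open D.
Hypothesis symD : forall x0 x1, D (x0, x1) -> D (x0, - x1).
Hypothesis F_C1 : forall k, C1_on (Eset D) (F k).
Hypothesis F_equi : forall A v, O3 A -> Eset D v ->
  forall i, F i (A *m v) = \sum_(j < 4) A i j *: F j v.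
Hypothesis F_eq : forall v, Eset D v ->
  [/\ pd (F i0) i0 v - pd (F i1) i1 v - pd (F i2) i2 v - pd (F i3) i3 v = 0,
      pd (F i0) i1 v + pd (F i1) i0 v - pd (F i2) i3 v + pd (F i3) i2 v = 0,
      pd (F i0) i2 v + pd (F i1) i3 v + pd (F i2) i0 v - pd (F i3) i1 v = 0 &
      pd (F i0) i3 v - pd (F i1) i2 v + pd (F i2) i1 v + pd (F i3) i0 v = 0].

Lemma cpt_E (x y : R) : D (x, y) -> Eset D (cpt x y).
Proof.
move=> Dxy; rewrite /Eset /=; have [-> -> -> ->] := cptE x y.
rewrite expr0n /= !addr0 sqrtr_sqr.
by have [y0|y0] := leP 0 y; [rewrite ger0_norm|rewrite ltr0_norm//; exact: symD].
Qed.

Lemma sum_scale_ebas (a b : R) (p q : 'I_4) v :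
  \sum_(j < 4) (a *: ebas R p + b *: ebas R q) j 0 *: F j v = a *: F p v + b *: F q v.
Proof.
have one (r : R) k : \sum_(j < 4) (r * (j == k)%:R) *: F j v = r *: F k v.
  rewrite (bigD1 k)//= eqxx mulr1 big1 ?addr0// => j /negbTE ->.
  by rewrite mulr0 scale0r.
rewrite -2!one -big_split /=; apply: eq_bigr => j _.
by rewrite -scalerDl !mxE eqxx !andbT.
Qed.

(* Equivariance under the Householder reflection with normal a e_p + b e_q. *)
Lemma reflection_equivariance (a b : R) (p q i : 'I_4) v : p != i0 -> q != i0 -> p != q ->
  a ^+ 2 + b ^+ 2 != 0 -> Eset D v ->
  F i (v - (2 * (a * vc v p + b * vc v q) / (a ^+ 2 + b ^+ 2)) *:
      (a *: ebas R p + b *: ebas R q)) =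
  F i v - (2 * (a *: ebas R p + b *: ebas R q) i 0 / (a ^+ 2 + b ^+ 2)) *:
      (a *: F p v + b *: F q v).
Proof.
move=> p0 q0 pq N0 Ev; set n := a *: ebas R p + b *: ebas R q.
set N := a ^+ 2 + b ^+ 2 in N0 *.
have nE j : n j 0 = a * (j == p)%:R + b * (j == q)%:R.
  by rewrite !mxE eqxx !andbT.
have dotn u : (n^T *m u) = (a * vc u p + b * vc u q)%:M.
  apply/matrixP => k l; rewrite !ord1 !mxE /= mulr1n.
  rewrite (eq_bigr (fun j => a * (j == p)%:R * u j 0 + b * (j == q)%:R * u j 0)).
    rewrite big_split /= (bigD1 p)//= [in X in _ + X](bigD1 q)//= !eqxx !mulr1.
    by rewrite !big1 ?addr0// => j /negbTE ->; rewrite mulr0 mul0r.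
  by move=> j _; rewrite mxE nE mulrDl.
have nn : n^T *m n = N%:M.
  have qp : (q == p) = false by rewrite eq_sym (negbTE pq).
  rewrite dotn !(vcD, vcZ, vc_ebas) !eqxx (negbTE pq) qp /=.
  by congr (_%:M); rewrite /N; ring.
pose A : 'M[R]_4 := 1%:M - (2 / N) *: (n *m n^T).
have AT : A^T = A by rewrite /A linearB linearZ /= trmx1 trmx_mul trmxK.
have OA : O3 A.
  split.
    rewrite AT /A mulmxBl mul1mx mulmxBr mulmx1 -scalemxAl -scalemxAr.
    rewrite mulmxA -(mulmxA n) nn mul_mx_scalar -scalemxAl !scalerA.
    rewrite (_ : 2 / N * (2 / N * N) = 2 / N + 2 / N); last by field.
    by rewrite scalerDl opprB addrK subrK.
  rewrite /A mulmxBl mul1mx -scalemxAl -mulmxA dotn !vc_ebas.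
  by rewrite (negbTE p0) (negbTE q0) !mulr0 addr0 mul_mx_scalar scale0r scaler0 subr0.
have -> : v - (2 * (a * vc v p + b * vc v q) / N) *: n = A *m v.
  rewrite /A mulmxBl mul1mx -scalemxAl -mulmxA dotn mul_mx_scalar scalerA.
  by congr (_ - _ *: _); field.
rewrite F_equi// (eq_bigr (fun j => (i == j)%:R *: F j v -
    (2 / N * n i 0) *: (n j 0 *: F j v))); last first.
  move=> j _; rewrite scalerA -scalerBl; congr (_ *: _); rewrite /A !mxE big_ord1 !mxE.
  by rewrite mulrA.
rewrite sumrB -scaler_sumr sum_scale_ebas; congr (_ - _).
  rewrite (bigD1 i)//= eqxx scale1r big1 ?addr0// => j /negbTE.
  by rewrite eq_sym => ->; rewrite scale0r.
by congr (_ *: _); field.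
Qed.

(** The reflection of the [k]-th coordinate fixes [v] and negates [F k v]. The index [q] only fills
    the second slot of the normal, with coefficient 0. *)
Lemma F_zero (k : 'I_4) v : k != i0 -> Eset D v -> vc v k = 0 -> F k v = 0.
Proof.
move=> k0 Ev vk.
have [q q0 kq] : exists2 q : 'I_4, q != i0 & k != q.
  by have [->|k1] := eqVneq k i1; [exists i2|exists i1].
have N1 : (1 : R) ^+ 2 + 0 ^+ 2 != 0 by rewrite expr1n expr0n addr0 oner_neq0.
have := @reflection_equivariance 1 0 k q k v k0 q0 kq N1 Ev.
rewrite vk !(mul0r, mulr0, addr0, expr0n, expr1n, scale0r, scale1r, subr0, divr1) /=.
rewrite !mxE !eqxx mulr1 => /eqP; rewrite eq_sym -subr_eq0 addrAC subrr add0r oppr_eq0.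
by rewrite scaler_eq0 pnatr_eq0 => /eqP.
Qed.

Lemma F_odd (x y : R) : D (x, y) -> F i1 (cpt x (- y)) = - F i1 (cpt x y).
Proof.
move=> Dxy; have N1 : (1 : R) ^+ 2 + 0 ^+ 2 != 0 by rewrite expr1n expr0n addr0 oner_neq0.
have := @reflection_equivariance 1 0 i1 i2 i1 _ isT isT isT N1 (cpt_E Dxy).
have [_ -> -> _] := cptE x y.
rewrite !(mul0r, mulr0, addr0, expr0n, expr1n, scale0r, scale1r, subr0, mul1r) /=.
rewrite !divr1 !mxE /= mulr1 scaler_nat mulr2n opprD addrA subrr sub0r => <-.
congr (F i1 _); rewrite /cpt -addrA -scalerBl; congr (_ + _ *: _); ring.
Qed.

(** In the plane of axes 1 and [k] the point has coordinates [(y, t)]. The reflection with normal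
    [(t, -y)] fixes it, so [t F_1 - y F_k], the component along the normal, vanishes. *)
Lemma F_cross (x y t : R) k : k != i0 -> k != i1 -> Eset D (cpt x y + t *: ebas R k) ->
  y *: F k (cpt x y + t *: ebas R k) = t *: F i1 (cpt x y + t *: ebas R k).
Proof.
move=> k0 k1; set v := _ + _ => Ev.
have [/andP[/eqP -> /eqP ->]|ty] := boolP ((t == 0) && (y == 0)).
  by rewrite !scale0r.
have N0 : t ^+ 2 + (- y) ^+ 2 != 0.
  by rewrite paddr_eq0 ?sqr_ge0// !sqrf_eq0 oppr_eq0.
have [_ c1 c2 c3] := cptE x y.
have vk : vc (cpt x y) k = 0.
  by case: (ord4P k) k0 k1 => ->.
have v1 : vc v i1 = y by rewrite vcD vcZ vc_ebas eq_sym (negbTE k1) c1 mulr0 addr0.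
have vk' : vc v k = t by rewrite vcD vcZ vc_ebas eqxx vk mulr1 add0r.
have k1' : i1 != k by rewrite eq_sym.
have E i := @reflection_equivariance t (- y) i1 k i v isT k0 k1' N0 Ev.
rewrite v1 vk' (_ : t * y + - y * t = 0) in E; last by ring.
rewrite mulr0 mul0r in E.
have {}E i : (2 * (t *: ebas R i1 + - y *: ebas R k) i 0 / (t ^+ 2 + (- y) ^+ 2)) *:
    (t *: F i1 v + - y *: F k v) = 0.
  have := E i; rewrite scale0r subr0 => /eqP.
  by rewrite eq_sym -subr_eq0 addrAC subrr add0r oppr_eq0 => /eqP.
suff : t *: F i1 v + - y *: F k v = 0.
  by rewrite scaleNr => /eqP; rewrite subr_eq0 => /eqP ->.
move: (E i1) (E k); rewrite !mxE !eqxx (negbTE k1) eq_sym (negbTE k1) /=.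
rewrite !(mulr0, mulr1, addr0, add0r); set X := t *: _ + _ => Xt Xy.
have X0 (c : R) : c != 0 -> (2 * c / (t ^+ 2 + (- y) ^+ 2)) *: X = 0 -> X = 0.
  move=> c0 /eqP; rewrite scaler_eq0 => /orP[|/eqP//].
  by rewrite mulf_eq0 invr_eq0 (negbTE N0) orbF mulf_eq0 (negbTE c0) pnatr_eq0.
have [t0|t0] := eqVneq t 0; last exact: X0 Xt.
apply: X0 Xy; rewrite oppr_eq0; apply: contra ty => y0.
by rewrite t0 eqxx.
Qed.

(** The reflection with normal [e_1 - e_k] exchanges the two coordinates. *)
Lemma F_swap (x t : R) k : k != i0 -> k != i1 -> D (x, t) ->
  F k (cpt x 0 + t *: ebas R k) = F i1 (cpt x t).
Proof.
move=> k0 k1 Dxt.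
have N0 : (1 : R) ^+ 2 + (- 1) ^+ 2 != 0 by rewrite sqrrN expr1n -[1 + 1]/(2%:R) pnatr_eq0.
have k1' : i1 != k by rewrite eq_sym.
have := @reflection_equivariance 1 (- 1) i1 k k _ isT k0 k1' N0 (cpt_E Dxt).
have [_ c1 c2 c3] := cptE x t.
have vk : vc (cpt x t) k = 0 by case: (ord4P k) k0 k1 => ->.
rewrite c1 vk mulr0 addr0 mul1r sqrrN expr1n !mxE eqxx (negbTE k1) /= !mulr0 add0r.
rewrite (_ : 2 * t / (1 + 1) = t); last by field.
rewrite eqxx (_ : 2 * (-1 * (true && true)%:R) / (1 + 1) = - 1); last by rewrite /= mulr1; field.
rewrite !scaleN1r !scale1r opprK addrCA subrr addr0 => <-; congr (F k _).
by rewrite /cpt scale0r addr0 scalerBr opprB addrACA subrr addr0.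
Qed.

Lemma E_near (x y : R) k : k != i0 -> k != i1 -> D (x, y) ->
  \forall t \near (0 : R), Eset D (cpt x y + t *: ebas R k).
Proof.
move=> k0 k1 Dxy.
pose g (t : R) : R := Num.sqrt (y ^+ 2 + t ^+ 2).
have gE t : Eset D (cpt x y + t *: ebas R k) <-> D (x, g t).
  rewrite /Eset /= !(vcD, vcZ, vc_ebas) /=.
  case: (ord4P k) k0 k1 => -> // _ _ /=;
  by rewrite !(mulr0, mulr1, addr0, add0r, expr0n) /= ?addr0.
have D0 : D (x, g 0).
  by apply/gE; rewrite scale0r addr0; exact: cpt_E.
have [r r0 rD] := open_box oD D0.
have cg : {for (0 : R), continuous g}.
  apply: (@cts_comp R _ (@Num.sqrt R) (fun t : R => y ^+ 2 + t ^+ 2)).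
    exact: sqrt_continuous.
  by apply: ctsD; [exact: cts_cst|apply: ctsX; exact: cvg_id].
move/ctsP: cg => /(_ r r0); apply: filterS => t tr; apply/gE; apply: rD.
  by rewrite subrr normr0 ltW.
by rewrite distrC ltW.
Qed.

Lemma der_unshift (h : R -> R) (x d : R) : der (fun t => h (x + t)) 0 d -> der h x d.
Proof.
move=> H; rewrite (_ : h = fun s => (fun t => h (x + t)) (- x + s)).
  by apply: (@der_shift _ (fun t => h (x + t))); rewrite addNr.
by apply/funext => s; rewrite addNKr.
Qed.

(** In the second Fueter equation the cross derivatives of [F_2] and [F_3] vanish at [cpt x y] by
    [F_zero], leaving [U_y = - V_x]. In the first, differentiating [F_cross] at [t = 0] gives
    [y d_k F_k = F_1] for [k = 2, 3], whence the term [2 V]; on the axis [F_swap] gives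
    [d_k F_k = d_1 F_1] instead, whence the factor 3. *)
Lemma stem_of_regular w : stem_system D
  (fun x y => oinner (F i0 (cpt x y)) w) (fun x y => oinner (F i1 (cpt x y)) w)
  (fun x y => oinner (pd (F i0) i0 (cpt x y)) w)
  (fun x y => oinner (pd (F i1) i0 (cpt x y)) w)
  (fun x y => oinner (pd (F i1) i1 (cpt x y)) w).
Proof.
have dl k i (x y : R) : D (x, y) ->
    der (fun t => oinner (F k (cpt x y + t *: ebas R i)) w) 0
      (oinner (pd (F k) i (cpt x y)) w).
  by move=> Dxy; apply: der_line_inner; apply: (F_C1 k i).1; exact: cpt_E.
have cx (x y t : R) : cpt x y + t *: ebas R i0 = cpt (x + t) y.
  by rewrite /cpt addrAC -scalerDl.
have cy (x y t : R) : cpt x y + t *: ebas R i1 = cpt x (y + t).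
  by rewrite /cpt -addrA -scalerDl.
have dx k (x y : R) : D (x, y) -> der (fun x => oinner (F k (cpt x y)) w) x
    (oinner (pd (F k) i0 (cpt x y)) w).
  move=> /(dl k i0) H; apply: der_unshift; apply: der_near H.
  by apply: (near0_ball ltr01) => t _; rewrite cx.
have dy k (x y : R) : D (x, y) -> der (fun y => oinner (F k (cpt x y)) w) y
    (oinner (pd (F k) i1 (cpt x y)) w).
  move=> /(dl k i1) H; apply: der_unshift; apply: der_near H.
  by apply: (near0_ball ltr01) => t _; rewrite cy.
have cpd k i (x y : R) : D (x, y) -> cts2 (fun x y => oinner (pd (F k) i (cpt x y)) w) x y.
  move=> Dxy; apply: cts2_inner; apply: (F_C1 k i).2.
  by rewrite inE; exact: cpt_E.
have offdiag k i (x y : R) : k != i0 -> k != i1 -> i != i0 -> i != i1 -> k != i ->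
    D (x, y) -> oinner (pd (F k) i (cpt x y)) w = 0.
  move=> k0 k1 ii0 ii1 ki Dxy; apply: (der_unique (dl k i x y Dxy)).
  apply: (@der_near _ (fun=> 0)); last exact: der_cst.
  apply: filterS (E_near ii0 ii1 Dxy) => t Et.
  rewrite F_zero ?oinner0l// vcD vcZ vc_ebas (negbTE ki) mulr0 addr0.
  by have [_ _ c2 c3] := cptE x y; case: (ord4P k) k0 k1 => ->.
have diag k (x y : R) : k != i0 -> k != i1 -> D (x, y) ->
    y * oinner (pd (F k) k (cpt x y)) w = oinner (F i1 (cpt x y)) w.
  move=> k0 k1 Dxy.
  have H1 := derMl y (dl k k x y Dxy).
  have H2 := derM (der_id 0) (dl i1 k x y Dxy).
  rewrite scale0r addr0 mul0r add0r mulr1 in H2.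
  apply: (der_unique H1); apply: der_near H2.
  apply: filterS (E_near k0 k1 Dxy) => t Et.
  by rewrite -!oinnerZl F_cross.
have diag0 k (x : R) : k != i0 -> k != i1 -> D (x, 0) ->
    oinner (pd (F k) k (cpt x 0)) w = oinner (pd (F i1) i1 (cpt x 0)) w.
  move=> k0 k1 Dx; apply: (der_unique (dl k k x 0 Dx)).
  apply: der_near (dl i1 i1 x 0 Dx).
  have [r r0 rD] := open_box oD Dx.
  apply: (near0_ball r0) => t tr; rewrite cy add0r F_swap//.
  by apply: rD; rewrite ?subrr ?normr0 ?subr0 ltW.
have e1 (p q r s : O) : p - q - r - s = 0 ->
    oinner p w - oinner q w - oinner r w - oinner s w = 0.
  by move=> E; rewrite -(oinner0l w) -E !oinnerBl.
have e2 (p q r s : O) : p + q - r + s = 0 -> oinner r w = 0 -> oinner s w = 0 ->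
    oinner p w = - oinner q w.
  move=> E r0 s0; have := oinner0l w; rewrite -E !oinnerDl oinnerNl r0 s0.
  by rewrite subr0 addr0 => /eqP; rewrite addr_eq0 => /eqP.
have e3 (y p q r s t : R) : p - q - r - s = 0 -> y * r = t -> y * s = t ->
    y * p = y * q + 2 * t.
  by move=> E <- ys; have -> : p = q + r + s; [lra|rewrite mulrDr ys; ring].
have e4 (p q r s : R) : p - q - r - s = 0 -> r = q -> s = q -> p = 3 * q.
  by move=> E rq sq; lra.
split.
- by move=> x y; exact: dx.
- move=> x y Dxy; apply: der_eq (dy i0 x y Dxy) _.
  have [_ E _ _] := F_eq (cpt_E Dxy).
  exact: (e2 _ _ _ _ E (offdiag i2 i3 x y isT isT isT isT isT Dxy)
    (offdiag i3 i2 x y isT isT isT isT isT Dxy)).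
- by move=> x y; exact: dx.
- by move=> x y; exact: dy.
- by move=> x y; exact: cpd.
- by move=> x y; exact: cpd.
- by move=> x y; exact: cpd.
- move=> x y Dxy; have [E _ _ _] := F_eq (cpt_E Dxy).
  exact: (e3 _ _ _ _ _ _ (e1 _ _ _ _ E) (diag i2 x y isT isT Dxy)
    (diag i3 x y isT isT Dxy)).
- move=> x Dx; have [E _ _ _] := F_eq (cpt_E Dx).
  exact: (e4 _ _ _ _ (e1 _ _ _ _ E) (diag0 i2 x isT isT Dx) (diag0 i3 x isT isT Dx)).
- by move=> x y Dxy; rewrite F_odd// oinnerNl.
Qed.

End Regular.
End StemOfRegular.

(** * Frames in the octonions and the projection to the half-plane *)

Section MaximumModulus.
Variable R : realType.
Local Notation O := (oct R).
Implicit Types (I J K e z p : O).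

Lemma oct_norm_le z (r : R) : 0 <= r -> oinner z z <= r ^+ 2 -> `|z| <= r.
Proof.
move=> r0 zr; rewrite [leLHS]/Num.Def.normr /= mx_normrE.
apply: bigmax_le => // -[i j] _ /=; rewrite (ord1 i).
rewrite -(ler_pXn2r (_ : 0 < 2)%N) ?nnegrE// real_normK ?num_real//.
apply: le_trans zr; rewrite /oinner (bigD1 j)//= -expr2 lerDl.
by apply: sumr_ge0 => k _; rewrite -expr2 sqr_ge0.
Qed.

Lemma norm_lt_coord (w : 'rV[R]_4) (r : R) : 0 < r ->
  (forall j, `|w ord0 j| < r) -> `|w| < r.
Proof.
move=> r0 H; rewrite [ltLHS]/Num.Def.normr /= mx_normrE.
by apply/bigmax_ltP; split => // -[i j] _ /=; rewrite (ord1 i).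
Qed.

Lemma pt4_coord (x y : R) k :
  pt4 x y ord0 k = if k == i0 then x else if k == i1 then y else 0.
Proof. by rewrite !mxE; case: (ord4P k) => -> /=; rewrite !(mulr0, mulr1, addr0, add0r). Qed.

Lemma oinner_frame I J (x y t : R) : sphereS I -> sphereS J -> oinner I J = 0 ->
  oinner (oreal x + y *: I + t *: J) (oreal x + y *: I + t *: J) =
  x ^+ 2 + y ^+ 2 + t ^+ 2.
Proof.
move=> /sphereSP[ha hI] /sphereSP[hb hJ] IJ.
have xx : oinner (oreal x) (oreal x) = x ^+ 2.
  by rewrite oinnerE !oc_real //=; ring.
have xI : oinner (oreal x) I = 0 by rewrite oinnerE !oc_real //= ha; ring.
have xJ : oinner (oreal x) J = 0 by rewrite oinnerE !oc_real //= hb; ring.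
have E (a b c : O) : oinner (a + y *: b + t *: c) (a + y *: b + t *: c) =
    oinner a a + y ^+ 2 * oinner b b + t ^+ 2 * oinner c c + 2 * y * oinner a b +
    2 * t * oinner a c + 2 * y * t * oinner b c.
  by rewrite !oinnerE !ocE; ring.
by rewrite E xx hI hJ xI xJ IJ; ring.
Qed.

(** The real part and the Euclidean length of the imaginary part: the continuous projection of the
    octonions onto the closed upper half-plane. *)
Definition pol z : R * R := (oc z 0, Num.sqrt (oinner z z - oc z 0 ^+ 2)).

Lemma polE (x y : R) I : sphereS I -> pol (oreal x + y *: I) = (x, `|y|).
Proof.
move=> SI; have [J SJ IJ] := sphereS_ortho SI.
have := oinner_frame x y 0 SI SJ IJ; rewrite scale0r !addr0 => E.
have /sphereSP[h0 _] := SI.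
rewrite /pol E ocD ocZ h0 oc_real//= mulr0 addr0; congr (_, _).
by rewrite expr0n addr0 addrAC subrr add0r sqrtr_sqr.
Qed.

Lemma pol_cts : continuous pol.
Proof.
move=> z.
have c0 : {for z, continuous (fun z : O => oc z 0)} by exact: coord_continuous.
have c1 : {for z, continuous (fun z : O => Num.sqrt (oinner z z - oc z 0 ^+ 2))}.
  apply: (@cts_comp R _ (@Num.sqrt R) (fun z : O => oinner z z - oc z 0 ^+ 2)).
    exact: sqrt_continuous.
  apply: ctsB; last exact: ctsX.
  by apply: cts_sum => j; apply: ctsM; exact: coord_continuous.
move=> A /near2P[d d0 dA].
move/ctsP: c0 => /(_ d d0) n0; move/ctsP: c1 => /(_ d d0) n1.
by apply: filterS2 n0 n1 => w h0 h1; apply: dA; rewrite distrC.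
Qed.

Section Stem.
Variables (D : set (R * R)) (f : O -> O) (u v : R -> R -> O).
Variables (Ux Vx Vy : O -> R -> R -> R).
Hypothesis oD : open D.
Hypothesis symD : forall x0 x1, D (x0, x1) -> D (x0, - x1).
Hypothesis sys : forall w, stem_system D (fun x y => oinner (u x y) w)
  (fun x y => oinner (v x y) w) (Ux w) (Vx w) (Vy w).
Hypothesis rep : forall x y K, D (x, y) -> sphereS K ->
  f (oreal x + y *: K) = u x y + omul K (v x y).
Hypothesis v_odd : forall x y, D (x, y) -> v x (- y) = - v x y.

Lemma inner_le e z : oinner z z <= oinner e e -> oinner z e <= oinner e e.
Proof.
move=> ze; have := oinner_ge0 (z - e).
have -> : oinner (z - e) (z - e) = oinner z z - 2 * oinner z e + oinner e e.
  by rewrite !oinnerE !ocE; ring.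
lra.
Qed.

Lemma eq_of_mean e z z' : oinner z z <= oinner e e -> oinner z' z' <= oinner e e ->
  oinner z e + oinner z' e = 2 * oinner e e -> z = e /\ z' = e.
Proof.
move=> h h' s; have i := inner_le h; have i' := inner_le h'.
by split; apply: eq_of_inner => //; lra.
Qed.

(** * A local maximum of the modulus makes the stem locally constant *)

Section LocalMaximum.
Variables (a b : R) (I e : O) (rho : R).
Hypothesis Dab : D (a, b).
Hypothesis SI : sphereS I.
Hypothesis eE : f (oreal a + b *: I) = e.
Hypothesis rho0 : 0 < rho.
Hypothesis fmax : forall z, `|z - (oreal a + b *: I)| < rho -> OmegaD D z ->
  oinner (f z) (f z) <= oinner e e.

Let p := oreal a + b *: I.

Lemma frame_close J (x y t d : R) : sphereS J -> oinner I J = 0 -> 0 < d ->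
  (x - a) ^+ 2 + (y - b) ^+ 2 + t ^+ 2 <= d ^+ 2 -> d < rho ->
  `|oreal x + y *: I + t *: J - p| < rho.
Proof.
move=> SJ IJ d0 xyt dr; apply: le_lt_trans dr; apply: oct_norm_le; first exact: ltW.
have -> : oreal x + y *: I + t *: J - p = oreal (x - a) + (y - b) *: I + t *: J.
  rewrite /p (_ : oreal (x - a) = oreal x - oreal a); last first.
    by apply: oct_ext; split; rewrite ocD ocN !oc_real //=; ring.
  by rewrite scalerBl opprD addrAC addrACA.
by rewrite oinner_frame.
Qed.

(** The factor 2 is the square root of the dimension, comparing the Euclidean norm with the maximum
    norm. *)
Lemma pt4_close (w : 'rV[R]_4) (d : R) : `|w - pt4 a b| < d ->
  (w ord0 i0 - a) ^+ 2 + (w ord0 i1 - b) ^+ 2 + (w ord0 i2 ^+ 2 + w ord0 i3 ^+ 2)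
    <= (2 * d) ^+ 2.
Proof.
move=> wd; apply: (@le_trans _ _ (sqdist (pt4 a b) w)).
  rewrite /sqdist sum4 /pt4 !mxE /= !(mulr0, mulr1, addr0, add0r, subr0).
  by rewrite addrA.
apply: le_trans (sqdist_le _ _) _.
have := normr_ge0 (w - pt4 a b); nra.
Qed.

Lemma near_stem : exists2 d : R, 0 < d & forall w : 'rV[R]_4, `|w - pt4 a b| < d ->
  D (w ord0 i0, rad w).
Proof.
have [p0 pr] := pt4E a b.
have D0 : D (a, `|b|).
  by have [b0|b0] := leP 0 b; [rewrite ger0_norm|rewrite ltr0_norm//; exact: symD].
have [r r0 rD] := open_box oD D0.
have /ctsP /(_ r r0) n0 := @coord_cts R i0 (pt4 a b).
have /ctsP /(_ r r0) n1 := @rad_cts R (pt4 a b).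
have /nbhs_ballP[d /= d0 dP] : nbhs (pt4 a b) [set w : 'rV[R]_4 | D (w ord0 i0, rad w)].
  apply: filterS2 n0 n1 => w h0 h1; apply: rD; rewrite ltW// distrC.
    by rewrite -p0.
  by rewrite -pr.
by exists d => // w wd; apply: dP; rewrite -ball_normE /= distrC.
Qed.

(** At a real point the average is taken over [I] and [- I], which leaves [u] alone; accordingly the
    second functional given to the maximum principle is 0. Equality then gives
    [u + I v = u - I v = e], so [v = 0]. Points with [y < 0] are reached by writing [y I] as
    [(- y) (- I)]. *)
Lemma local_max_axis : b = 0 -> exists2 r : R, 0 < r & forall x y,
  `|x - a| < r -> `|y - b| < r -> [/\ D (x, y), u x y = e & v x y = 0].
Proof.
move=> b0; have rho_gt0 := rho0; have [d1 d10 d1D] := near_stem.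
have [J SJ IJ] := sphereS_ortho SI.
pose d := Num.min d1 (rho / 4).
have d0 : 0 < d by rewrite lt_min d10 divr_gt0.
have dP (w : 'rV[R]_4) : `|w - pt4 a b| < d -> [/\ D (w ord0 i0, rad w),
    oinner (f (oreal (w ord0 i0) + rad w *: I)) (f (oreal (w ord0 i0) + rad w *: I))
      <= oinner e e &
    oinner (f (oreal (w ord0 i0) + rad w *: - I)) (f (oreal (w ord0 i0) + rad w *: - I))
      <= oinner e e].
  rewrite lt_min => /andP[/d1D Dw wr]; have := pt4_close wr.
  rewrite b0 subr0 => close.
  have {}close : (w ord0 i0 - a) ^+ 2 + rad w ^+ 2 <= (2 * (rho / 4)) ^+ 2.
    by rewrite sqr_rad; lra.
  have H (t : R) : t ^+ 2 = rad w ^+ 2 -> `|oreal (w ord0 i0) + t *: I - p| < rho.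
    move=> tE; have := @frame_close J (w ord0 i0) t 0 (2 * (rho / 4)) SJ IJ.
    have h1 : 0 < 2 * (rho / 4) by rewrite mulr_gt0 ?divr_gt0.
    have h2 : 2 * (rho / 4) < rho by have := rho0; lra.
    rewrite scale0r addr0 b0 subr0 expr0n addr0 tE => H.
    exact: H h1 close h2.
  split => //; apply: fmax.
  - exact: H.
  - by exists (w ord0 i0), (rad w), I.
  - by rewrite scalerN -scaleNr; apply: H; rewrite sqrrN.
  - by exists (w ord0 i0), (rad w), (- I); split => //; split => //; exact: sphereSN.
(* Oddness of [v] at [y = 0] makes [v a 0] its own negative. *)
have e_ab : e = u a 0.
  rewrite -eE rep// b0; have := v_odd Dab; rewrite b0 oppr0 => /eqP.
  rewrite -subr_eq0 opprK -mulr2n -scaler_nat scaler_eq0 pnatr_eq0 /= => /eqP ->.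
  by rewrite omul0r addr0.
have [p0 pr] := pt4E a b.
have smax (w : 'rV[R]_4) : `|w - pt4 a b| < d ->
    oinner (u (w ord0 i0) (rad w)) e +
    w ord0 i1 / rad w * oinner (v (w ord0 i0) (rad w)) 0 <=
    oinner (u (pt4 a b ord0 i0) (rad (pt4 a b))) e + pt4 a b ord0 i1 / rad (pt4 a b) *
      oinner (v (pt4 a b ord0 i0) (rad (pt4 a b))) 0.
  move=> /dP[Dw h h']; have := inner_le h; have := inner_le h'.
  rewrite (rep Dw SI) (rep Dw (sphereSN SI)) omulNl !oinnerDl oinnerNl.
  by rewrite !(oinnerC _ 0) !oinner0l !mulr0 !addr0 p0 pr b0 normr0 -e_ab; lra.
have [|d2 d20 d2P] := stem_strong_maximum oD (sys e) (sys 0) Dab _ d0 smax.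
  by right; split => // x y; rewrite oinnerC oinner0l.
pose d3 := Num.min d d2.
have d30 : 0 < d3 by rewrite lt_min d0.
have key (w : 'rV[R]_4) : `|w - pt4 a b| < d3 ->
    u (w ord0 i0) (rad w) = e /\ v (w ord0 i0) (rad w) = 0.
  rewrite lt_min => /andP[/dP[Dw h h'] /d2P].
  rewrite !(oinnerC _ 0) !oinner0l !mulr0 !addr0 p0 pr b0 normr0 -e_ab => E.
  have [|] := eq_of_mean h h'.
    rewrite (rep Dw SI) (rep Dw (sphereSN SI)) omulNl !oinnerDl oinnerNl.
    by rewrite E; ring.
  rewrite (rep Dw SI) (rep Dw (sphereSN SI)) omulNl => e1 e2.
  have Iv0 : omul I (v (w ord0 i0) (rad w)) = 0.
    have /eqP : 2 *: omul I (v (w ord0 i0) (rad w)) = 0.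
      rewrite scaler_nat mulr2n; apply/eqP; rewrite addr_eq0; apply/eqP.
      by apply: (addrI (u (w ord0 i0) (rad w))); rewrite e1 e2.
    by rewrite scaler_eq0 pnatr_eq0 => /eqP.
  by split; [rewrite -e1 Iv0 addr0|exact: sphereS_mul_eq0 Iv0].
exists d3 => // x y xd yd.
have close : `|pt4 x y - pt4 a b| < d3.
  apply: norm_lt_coord => // k; rewrite mxE [X in _ + X]mxE !pt4_coord.
  by case: (ord4P k) => -> //=; rewrite subrr normr0.
have [x0 yr] := pt4E x y; have := key _ close; rewrite x0 yr => -[uE vE].
have Dxy : D (x, `|y|).
  by rewrite -{1}x0 -yr; apply: d1D; move: close; rewrite !lt_min -andbA => /and3P[].
have [y0|y0] := leP 0 y; first by move: Dxy uE vE; rewrite ger0_norm.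
move: Dxy uE vE; rewrite ltr0_norm// => Dxy uE vE.
have Dxy' : D (x, y) by rewrite -[y]opprK; exact: symD.
have vE' : v x y = 0 by rewrite -[y]opprK v_odd// vE oppr0.
split => //; have := rep Dxy' SI; rewrite vE' omul0r addr0 => <-.
rewrite -[y *: I]opprK -scaleNr -scalerN (rep Dxy (sphereSN SI)).
by rewrite uE vE omul0r addr0.
Qed.

(** A vector [w] of R^4 is sent to the two points [w_0 + w_1 I +- im w J], which are [w_0 + rad w K]
    for the units [K 1 w] and [K (-1) w]. The identity [mean] shows that the average over the two
    signs is the function to which the strong maximum principle applies. Where [w_2] is nonzero the
    two units differ, so equality of the two values of [f] forces [v = 0]. *)
Lemma local_max_off_axis : 0 < b -> exists2 r : R, 0 < r & forall x y,
  `|x - a| < r -> `|y - b| < r -> [/\ D (x, y), u x y = e & v x y = 0].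
Proof.
move=> b0; have rho_gt0 := rho0; have [d1 d10 d1D] := near_stem.
have [J SJ IJ] := sphereS_ortho SI.
have [d d0 [dd1 dr db]] : exists2 d : R, 0 < d & [/\ d <= d1, d <= rho / 4 & d <= b / 2].
  exists (Num.min d1 (Num.min (rho / 4) (b / 2))).
    by rewrite !lt_min d10 !divr_gt0.
  by rewrite !ge_min !lexx !orbT.
pose im (w : 'rV[R]_4) : R := Num.sqrt (w ord0 i2 ^+ 2 + w ord0 i3 ^+ 2).
have im2 w : im w ^+ 2 = w ord0 i2 ^+ 2 + w ord0 i3 ^+ 2.
  by rewrite sqr_sqrtr// addr_ge0 ?sqr_ge0.
pose K (s : R) (w : 'rV[R]_4) : O := (w ord0 i1 / rad w) *: I + (s * im w / rad w) *: J.
have rad0 (w : 'rV[R]_4) : `|w - pt4 a b| < d -> 0 < rad w.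
  move=> wd; have c1 := coord_norm_le (w - pt4 a b) i1.
  rewrite !mxE /= !(mulr0, mulr1, addr0, add0r) in c1.
  have {}c1 : `|w ord0 i1 - b| < b by lra.
  move: c1; rewrite ltr_norml => /andP[c1 _].
  rewrite lt_neqAle rad_ge0 andbT eq_sym; apply/eqP => r0.
  by have := @rad_eq0 R w i1 r0 isT; lra.
have SK s w : s ^+ 2 = 1 -> `|w - pt4 a b| < d -> sphereS (K s w).
  move=> s2 /rad0 /lt0r_neq0 wr; apply: sphereS_comb => //.
  rewrite !expr_div_n exprMn s2 mul1r im2 -mulrDl addrA -sqr_rad divff//.
  by rewrite expf_neq0.
have KE s w : `|w - pt4 a b| < d -> oreal (w ord0 i0) + rad w *: K s w =
    oreal (w ord0 i0) + w ord0 i1 *: I + (s * im w) *: J.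
  move=> /rad0 /lt0r_neq0 wr; rewrite /K scalerDr !scalerA addrA.
  by rewrite ![rad w * (_ / _)]mulrC !divfK.
have dP s (w : 'rV[R]_4) : s ^+ 2 = 1 -> `|w - pt4 a b| < d ->
    oinner (f (oreal (w ord0 i0) + rad w *: K s w)) (f (oreal (w ord0 i0) + rad w *: K s w))
      <= oinner e e.
  move=> s2 wd; have Dw : D (w ord0 i0, rad w) by apply: d1D; exact: lt_le_trans dd1.
  apply: fmax; last by exists (w ord0 i0), (rad w), (K s w); split=> //; split=> //; exact: SK.
  rewrite KE//; apply: (@frame_close _ _ _ _ (2 * (rho / 4))) => //; [lra| |lra].
  rewrite exprMn s2 mul1r im2; apply: pt4_close; exact: lt_le_trans dr.
have Dw w : `|w - pt4 a b| < d -> D (w ord0 i0, rad w).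
  by move=> wd; apply: d1D; exact: lt_le_trans dd1.
have s1 : (1 : R) ^+ 2 = 1 by rewrite expr1n.
have s2 : (-1 : R) ^+ 2 = 1 by rewrite sqrrN expr1n.
have mean w : `|w - pt4 a b| < d ->
    oinner (f (oreal (w ord0 i0) + rad w *: K 1 w)) e +
    oinner (f (oreal (w ord0 i0) + rad w *: K (-1) w)) e =
    2 * (oinner (u (w ord0 i0) (rad w)) e +
      w ord0 i1 / rad w * oinner (v (w ord0 i0) (rad w)) (- omul I e)).
  move=> wd; rewrite (rep (Dw w wd) (SK _ _ s1 wd)) (rep (Dw w wd) (SK _ _ s2 wd)).
  rewrite /K !omulDl !omulZl !oinnerDl !oinnerZl -(oinner_mul _ _ SI).
  by rewrite mul1r mulN1r mulNr; ring.
have [p0 pr] := pt4E a b.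
have p1 : pt4 a b ord0 i1 = b by rewrite !mxE /= mulr0 mulr1 add0r.
have val : oinner (u (pt4 a b ord0 i0) (rad (pt4 a b))) e +
    pt4 a b ord0 i1 / rad (pt4 a b) *
      oinner (v (pt4 a b ord0 i0) (rad (pt4 a b))) (- omul I e) = oinner e e.
  rewrite p0 p1 pr gtr0_norm// divff ?gt_eqF// mul1r -(oinner_mul _ _ SI) -oinnerDl.
  by rewrite -rep// eE.
have smax (w : 'rV[R]_4) : `|w - pt4 a b| < d ->
    oinner (u (w ord0 i0) (rad w)) e +
    w ord0 i1 / rad w * oinner (v (w ord0 i0) (rad w)) (- omul I e) <=
    oinner (u (pt4 a b ord0 i0) (rad (pt4 a b))) e + pt4 a b ord0 i1 / rad (pt4 a b) *
      oinner (v (pt4 a b ord0 i0) (rad (pt4 a b))) (- omul I e).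
  move=> wd; rewrite val; have := mean w wd.
  by have := inner_le (dP _ _ s1 wd); have := inner_le (dP _ _ s2 wd); lra.
have [d2 d20 d2P] := stem_strong_maximum oD (sys e) (sys (- omul I e)) Dab
  (or_introl b0) d0 smax.
have [d3 d30 [d3d d3d2]] : exists2 d3 : R, 0 < d3 & d3 <= d /\ d3 <= d2.
  by exists (Num.min d d2); [rewrite lt_min d0|rewrite !ge_min !lexx orbT].
have key (w : 'rV[R]_4) : `|w - pt4 a b| < d3 -> w ord0 i2 != 0 ->
    u (w ord0 i0) (rad w) = e /\ v (w ord0 i0) (rad w) = 0.
  move=> wd3 w2.
  have wd : `|w - pt4 a b| < d by exact: lt_le_trans d3d.
  have wd2 : `|w - pt4 a b| < d2 by exact: lt_le_trans d3d2.
  have := d2P w wd2; rewrite val => E.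
  have := mean w wd; rewrite E => E'.
  have [] := eq_of_mean (dP _ _ s1 wd) (dP _ _ s2 wd) E'.
  rewrite (rep (Dw w wd) (SK _ _ s1 wd)) (rep (Dw w wd) (SK _ _ s2 wd)) => e1 e2.
  have v0 : v (w ord0 i0) (rad w) = 0.
    apply: (sphereS_mul_eq0 SJ).
    have imn : im w != 0.
      apply/eqP => i_0; have := im2 w; rewrite i_0 expr0n /= => /eqP.
      by rewrite eq_sym paddr_eq0 ?sqr_ge0// sqrf_eq0 (negbTE w2).
    have /eqP : (2 * im w / rad w) *: omul J (v (w ord0 i0) (rad w)) = 0.
      have /(addrI (u (w ord0 i0) (rad w))) : u (w ord0 i0) (rad w) + omul (K 1 w) (v (w ord0 i0) (rad w)) =
        u (w ord0 i0) (rad w) + omul (K (-1) w) (v (w ord0 i0) (rad w)) by rewrite e1 e2.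
      rewrite /K !omulDl => /addrI; rewrite !omulZl => /eqP.
      rewrite -subr_eq0 -scalerBl => /eqP <-; congr (_ *: _); ring.
    rewrite scaler_eq0 => /orP[|/eqP//].
    by rewrite mulf_eq0 invr_eq0 (gt_eqF (rad0 w wd)) orbF mulf_eq0 pnatr_eq0 (negbTE imn).
  by split => //; rewrite -e1 v0 omul0r addr0.
(* The circle of radius y through (y, 0) is parametrised rationally, so that a point off
   the I-axis with the same radius is available. *)
pose s := Num.min 1 (d3 / (8 * (b + 1))).
have b1 : 0 < b + 1 by lra.
have s0 : 0 < s by rewrite lt_min ltr01 divr_gt0// mulr_gt0.
have sle : s <= 1 by rewrite ge_min lexx.
have sb : 2 * (b + 1) * s <= d3 / 4.
  have : s <= d3 / (8 * (b + 1)) by rewrite ge_min lexx orbT.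
  rewrite -(ler_pM2l (_ : 0 < 2 * (b + 1))) ?mulr_gt0// => /le_trans; apply.
  rewrite le_eqVlt; apply/orP; left; apply/eqP; field.
  by rewrite lt0r_neq0.
(* The bounds 1 and [b / 2] give [0 < y < b + 1], on which the choice of [s] relies; passing to the
   auxiliary point [w] costs at most [d3 / 4] per coordinate on top of [d3 / 2]. *)
pose r := Num.min (d3 / 2) (Num.min 1 (b / 2)).
exists r; first by rewrite !lt_min ltr01 !divr_gt0.
move=> x y; rewrite !lt_min => /and3P[xd _ _] /and3P[yd y1 yb].
move: y1 yb; rewrite !ltr_norml => /andP[_ y1] /andP[yb _].
have y0 : 0 < y by lra.
have q0 : 0 < 1 + s ^+ 2 by rewrite ltr_wpDr ?sqr_ge0.
pose w : 'rV[R]_4 := x *: bas R i0 + (y * (1 - s ^+ 2) / (1 + s ^+ 2)) *: bas R i1 +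
  (y * (2 * s) / (1 + s ^+ 2)) *: bas R i2.
have w0 : w ord0 i0 = x by rewrite !mxE /= !(mulr0, mulr1, addr0).
have w1 : w ord0 i1 = y * (1 - s ^+ 2) / (1 + s ^+ 2).
  by rewrite !mxE /= !(mulr0, mulr1, addr0, add0r).
have w2 : w ord0 i2 = y * (2 * s) / (1 + s ^+ 2).
  by rewrite !mxE /= !(mulr0, mulr1, addr0, add0r).
have w3 : w ord0 i3 = 0 by rewrite !mxE /= !(mulr0, addr0).
have wr : rad w = y.
  apply/eqP; rewrite -(@eqrXn2 _ 2) ?rad_ge0 ?ltW//; apply/eqP.
  by rewrite sqr_rad w1 w2 w3; field; rewrite lt0r_neq0.
have le1 (t : R) : 0 <= t -> t / (1 + s ^+ 2) <= t.
  by move=> t0; rewrite ler_pdivrMr// ler_peMr// lerDl sqr_ge0.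
have ys : y * (2 * s) <= d3 / 4 by apply: le_trans sb; nra.
have w2d : y * (2 * s) / (1 + s ^+ 2) <= d3 / 4.
  apply: le_trans (le1 _ _) _; first by rewrite !mulr_ge0// ltW.
  exact: ys.
have w1d : y - y * (1 - s ^+ 2) / (1 + s ^+ 2) <= d3 / 4.
  rewrite (_ : _ - _ = y * (2 * s ^+ 2) / (1 + s ^+ 2)); last first.
    by field; rewrite lt0r_neq0.
  apply: le_trans (le1 _ _) _; first by rewrite !mulr_ge0// ?sqr_ge0// ltW.
  apply: le_trans ys; rewrite ler_pM2l// ler_pM2l// expr2 ler_piMl//.
  exact: ltW.
have w1d' : 0 <= y - y * (1 - s ^+ 2) / (1 + s ^+ 2).
  rewrite (_ : _ - _ = y * (2 * s ^+ 2) / (1 + s ^+ 2)); last first.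
    by field; rewrite lt0r_neq0.
  by rewrite divr_ge0 ?mulr_ge0 ?sqr_ge0 ?ltW.
have w20 : 0 < y * (2 * s) / (1 + s ^+ 2) by rewrite divr_gt0// !mulr_gt0.
have wclose : `|w - pt4 a b| < d3.
  apply: norm_lt_coord => // k; rewrite mxE [X in _ + X]mxE.
  rewrite pt4_coord; case: (ord4P k) => -> /=; rewrite ?w0 ?w1 ?w2 ?w3 ?subr0 ?normr0//.
  - lra.
  - have := ler_normD (y * (1 - s ^+ 2) / (1 + s ^+ 2) - y) (y - b); rewrite subrKA.
    rewrite (distrC _ y) (ger0_norm w1d'); lra.
  - by rewrite gtr0_norm//; lra.
have wd : `|w - pt4 a b| < d by exact: lt_le_trans d3d.
have := key w wclose; rewrite w2 lt0r_neq0// => /(_ isT).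
by have := Dw w wd; rewrite w0 wr => Dxy [uE vE]; split.
Qed.

End LocalMaximum.

(** * Propagation of the constant value over the connected domain *)

Lemma stem_system_shift (U V Ux' Vx' Vy' : R -> R -> R) (k : R) :
  stem_system D U V Ux' Vx' Vy' -> stem_system D (fun x y => U x y - k) V Ux' Vx' Vy'.
Proof.
case=> h1 h2 h3 h4 h5 h6 h7 h8 h9 h10; split => // x y Dxy.
  by apply: der_eq (derB (h1 x y Dxy) (der_cst k x)) _; rewrite subr0.
by apply: der_eq (derB (h2 x y Dxy) (der_cst k y)) _; rewrite subr0.
Qed.

(** Local constancy is stated for the stem in the plane, where unique continuation applies, and is
    carried to [OmegaD D] by [pol]. *)
Definition flat e : set (R * R) :=
  [set z | \forall z' \near z, [/\ D z', u z'.1 z'.2 = e & v z'.1 z'.2 = 0]].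

Lemma flat_open e : open (flat e).
Proof.
by rewrite openE => z; rewrite /flat /interior /=; exact: nbhs_interior.
Qed.

(** Continuation starts from a flat point within [rho / 8] of [z] and reaches the disc of radius
    [rho / 4] about it. That disc contains the box of half-side [rho / 64] about [z], whose
    coordinates differ by less than [9 rho / 64] from the start: [2 * 9^2 < 16^2]. *)
Lemma flat_closed e (z : R * R) : D z -> closure (flat e) z -> flat e z.
Proof.
case: z => x y Dxy; have [rho rho0 box] := open_box oD Dxy.
move=> cl.
have /cl[[x' y'] [/near2P[d d0 dP] [/= xx yy]]] : nbhs (x, y) (ball (x, y) (rho / 8)).
  by apply: nbhsx_ballx; rewrite divr_gt0.
rewrite /ball /= in xx yy.
have box' (p q : R) : `|p - x'| <= rho / 2 -> `|q - y'| <= rho / 2 -> D (p, q).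
  move=> px qy; apply: box.
    by have := ler_normD (p - x') (x' - x); rewrite subrKA (distrC x'); lra.
  by have := ler_normD (q - y') (y' - y); rewrite subrKA (distrC y'); lra.
have r20 : 0 < rho / 2 by rewrite divr_gt0.
have uv (p q : R) : (p - x') ^+ 2 + (q - y') ^+ 2 < (rho / 2 / 2) ^+ 2 ->
    u p q = e /\ v p q = 0.
  move=> pq.
  (* The scalar result holds for every functional [w]; the choices [w = u p q - e] and [w = v p q]
     then give the vector equations. *)
  have H w : oinner (u p q) w - oinner e w = 0 /\ oinner (v p q) w = 0.
    have := @stem_unique_continuation R D _ _ _ _ _ (stem_system_shift (oinner e w) (sys w))
      oD x' y' (rho / 2) d r20 d0 box' _ p q pq.
    apply=> p' q' pd qd; have [_ -> ->] := dP p' q' pd qd.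
    by rewrite subrr oinner0l.
  split; last by apply: oinner_eq0; have [] := H (v p q).
  apply/eqP; rewrite -subr_eq0; apply/eqP/oinner_eq0.
  by rewrite oinnerBl; have [] := H (u p q - e).
apply/near2P; exists (rho / 64); first by rewrite divr_gt0.
move=> p q px qy /=.
have px' : `|p - x'| < 9 * rho / 64.
  by have := ler_normD (p - x) (x - x'); rewrite subrKA; lra.
have qy' : `|q - y'| < 9 * rho / 64.
  by have := ler_normD (q - y) (y - y'); rewrite subrKA; lra.
have sq (t : R) : `|t| < 9 * rho / 64 -> t ^+ 2 < (9 * rho / 64) ^+ 2.
  by move=> tr; rewrite -(real_normK (num_real t)) ltrXn2r// ?nnegrE//; lra.
have [|-> ->] := uv p q.
  have := sq _ px'; have := sq _ qy'; nra.
by split => //; apply: box'; lra.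
Qed.

(** On [D] the set [flat e] agrees with its closure, so its preimage under the continuous map [pol]
    is relatively open and relatively closed in [OmegaD D]. *)
Lemma regular_constant e p : connected (OmegaD D) -> OmegaD D p -> flat e (pol p) ->
  forall z, OmegaD D z -> f z = e.
Proof.
move=> cO Op fp.
have Dabs (x y : R) : D (x, y) -> D (x, `|y|).
  by move=> Dxy; have [y0|y0] := leP 0 y; [rewrite ger0_norm|rewrite ltr0_norm//; exact: symD].
have ODpol z : OmegaD D z -> D (pol z).
  by move=> [x [y [I [Dxy [SI ->]]]]]; rewrite polE//; exact: Dabs.
have E : OmegaD D `&` pol @^-1` flat e = OmegaD D.
  apply: cO.
  - by exists p.
  - exists (pol @^-1` flat e) => //.
    by apply: (@open_comp _ _ pol (flat e)); [move=> z _; exact: pol_cts|exact: flat_open].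
  - exists (pol @^-1` closure (flat e)).
      by apply: (@closed_comp _ _ pol (closure (flat e)));
        [move=> z _; exact: pol_cts|exact: closed_closure].
    apply/seteqP; split => z [Oz fz]; split => //=; first exact: subset_closure.
    by apply: flat_closed => //; exact: ODpol.
move=> z; rewrite -{1}E => -[[x [y [I [Dxy [SI ->]]]]]] /=.
rewrite polE// => /nbhs_singleton /= [Dxy' uE vE].
have [y0|y0] := leP 0 y.
  by move: uE vE; rewrite ger0_norm// => uE vE; rewrite rep// uE vE omul0r addr0.
rewrite -[y *: I]opprK -scaleNr -scalerN.
rewrite (rep (symD Dxy) (sphereSN SI)).
by move: uE vE; rewrite ltr0_norm// => -> ->; rewrite omul0r addr0.
Qed.

End Stem.
End MaximumModulus.

Theorem theorem2p37 (R : realType) (D : set (R * R)) (f : oct R -> oct R) :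
  open D -> D !=set0 ->
  (forall x0 x1, D (x0, x1) -> D (x0, - x1)) ->
  connected (OmegaD D) ->
  slice_fueter_regular D f ->
  ((exists p, OmegaD D p /\ forall x, OmegaD D x -> onorm (f x) <= onorm (f p)) \/
   (exists p, OmegaD D p /\ ~ Vsd D f p /\
      \forall x \near p, OmegaD D x -> onorm (f x) <= onorm (f p))) ->
  exists c : oct R, forall x, OmegaD D x -> f x = c.
Proof.
move=> oD _ symD cO [F [C1 [equi [repF eqs]]]] H.
have [p [Op mp]] : exists p, OmegaD D p /\
    \forall x \near p, OmegaD D x -> onorm (f x) <= onorm (f p).
  case: H => [[p [Op mp]]|[p [Op [_ mp]]]]; exists p; split => //.
  by apply/nbhs_ballP; exists 1 => //= x _; exact: mp.
have sys := stem_of_regular oD symD C1 equi eqs.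
(* At [cpt x y] any unit orthogonal to [K] may complete the frame, since [F_2] and [F_3] vanish
   there by [F_zero]. *)
have rep x y K : D (x, y) -> sphereS K ->
    f (oreal x + y *: K) = F i0 (cpt x y) + omul K (F i1 (cpt x y)).
  move=> Dxy SK; have [J SJ KJ] := sphereS_ortho SK.
  have Ev := cpt_E symD Dxy; have [c0 c1 c2 c3] := cptE x y.
  have := repF _ _ _ Ev SK SJ KJ; rewrite c0 c1 c2 c3 !scale0r !addr0 => ->.
  rewrite (F_zero equi (k := i2) isT Ev c2) (F_zero equi (k := i3) isT Ev c3).
  by rewrite !omul0r !addr0.
have odd := F_odd symD equi.
(* Replacing [I] by [- I] makes [b] nonnegative, so that [(a, b)] is [pol p]. *)
have [a [b [I [Dab [SI [b0 pE]]]]]] : exists a b I,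
    D (a, b) /\ sphereS I /\ 0 <= b /\ p = oreal a + b *: I.
  case: Op => [a [b [I [Dab [SI pE]]]]]; have [b0|b0] := leP 0 b.
    by exists a, b, I.
  exists a, (- b), (- I); split; first exact: symD.
  split; first exact: sphereSN.
  by rewrite scalerN scaleNr opprK oppr_ge0 ltW.
have /nbhs_ballP[rho /= rho0 rhoP] := mp.
exists (f p); apply: (regular_constant oD symD sys rep cO Op).
have fmax z : `|z - (oreal a + b *: I)| < rho -> OmegaD D z ->
    oinner (f z) (f z) <= oinner (f p) (f p).
  move=> zp Oz; apply: onorm_le; apply: rhoP => //.
  by rewrite -ball_normE /= distrC pE.
have eE : f (oreal a + b *: I) = f p by rewrite pE.
rewrite {2}pE (polE _ _ SI) (ger0_norm b0).
have [r r0 rP] : exists2 r : R, 0 < r & forall x y, `|x - a| < r -> `|y - b| < r ->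
    [/\ D (x, y), F i0 (cpt x y) = f p & F i1 (cpt x y) = 0].
  move: b0; rewrite le_eqVlt => /orP[/eqP b0|b0].
    exact: (local_max_axis oD symD sys rep odd Dab SI eE rho0 fmax (esym b0)).
  exact: (local_max_off_axis oD symD sys rep Dab SI eE rho0 fmax b0).
by apply/near2P; exists r.
Qed.
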